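(* Let $r\ge 1$. Every nondeterministically testable $r$-graph property is testable.
   Context: Notation: $[n]=\{1,\dots,n\}$. A simple $r$-graph on $n$ vertices is a subset $G\subseteq \binom{[n]}{r}$. For a finite set $C$, a $C$-colored $r$-graph on $[n]$ assigns to each $e\in\binom{[n]}{r}$ exactly one color from $C$. A simple $r$-graph is regarded as a $2$-colored $r$-graph (edges/non-edges). A property of (simple or $C$-colored) $r$-graphs is a set of such $r$-graphs that is invariant under relabeling of vertices. For $1\le q\le n$ and a (simple or colored) $r$-graph $G$ on $n$ vertices, $\mathbb G(q,G)$ denotes the random $r$-graph on $q$ vertices induced by $G$ on a uniformly random $q$-element subset of its vertices. For a property $\mathcal P$ and $\varepsilon>0$, an $r$-graph $G$ is $\varepsilon$-far from $\mathcal P$ if one has to modify (in the colored case: recolor) at least $\varepsilon|V(G)|^r$ edges of $G$ in order to obtain an element of $\mathcal P$. Testable: an $r$-graph property $\mathcal P$ is testable if there exists another $r$-graph property $\hat{\mathcal P}$ (the sample property) such that (a) $\mathbb P(\mathbb G(q,G)\in\hat{\mathcal P})\ge \frac23$ for every $G\in\mathcal P$ and every $q\ge1$ (with $q\le|V(G)|$), and (b) for every $\varepsilon>0$ there is an integer $q_{\mathcal P}(\varepsilon)\ge1$ such that for every $q\ge q_{\mathcal P}(\varepsilon)$ and every $G$ (with $|V(G)|\ge q$) that is $\varepsilon$-far from $\mathcal P$ we have $\mathbb P(\mathbb G(q,G)\in\hat{\mathcal P})\le\frac13$. Testability of properties of colored $r$-graphs is defined in the same way. Discoloring: for a $[2]\times[k]$-colored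 (also called $2k$-colored) $r$-graph $\mathbf G$, its $k$-discoloring $[\mathbf G,k]$ is the $2$-colored (i.e. simple) $r$-graph obtained by keeping only the first coordinate of each edge color. Nondeterministically testable: an $r$-graph property $\mathcal P$ is nondeterministically testable if there exist an integer $k\ge1$ and a $2k$-colored $r$-graph property $\mathcal Q$ (the witness property) that is testable in the sense above and satisfies $\{[\mathbf G,k] : \mathbf G\in\mathcal Q\}=\mathcal P$. *)

(* Defs.v *)
From mathcomp Require Import all_boot all_order all_algebra all_fingroup.
From mathcomp Require Import reals.

Set Implicit Arguments.
Unset Strict Implicit.
Unset Printing Implicit Defensive.

Import Order.TTheory GRing.Theory Num.Theory.
Local Open Scope ring_scope.

Definition redge (r n : nat) := {e : {set 'I_n} | #|e| == r}.

Definition cgraph (r : nat) (C : finType) (n : nat) := {ffun redge r n -> C}.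

(* A simple r-graph, as a set of r-subsets of the vertex set, is represented
   by its indicator function: color [true] means edge. *)
Definition rgraph (r n : nat) := cgraph r bool n.

Lemma card_redge_imset r m n (f : 'I_m -> 'I_n) (f_inj : injective f)
    (e : redge r m) : #|f @: val e| == r.
Proof. by rewrite (card_imset _ f_inj) (valP e). Qed.

Definition redge_imset r m n (f : 'I_m -> 'I_n) (f_inj : injective f)
    (e : redge r m) : redge r n :=
  exist _ (f @: val e) (card_redge_imset f_inj e).

Definition pullback r C m n (f : 'I_m -> 'I_n) (f_inj : injective f)
    (G : cgraph r C n) : cgraph r C m :=
  [ffun e => G (redge_imset f_inj e)].

Definition relabel r C n (s : 'S_n) (G : cgraph r C n) : cgraph r C n :=
  pullback (@perm_inj _ s) G.

(* The subgraph induced on S, its vertices being numbered in increasing order.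
   The choice of numbering is immaterial for membership in a property. *)
Definition induced r C n (G : cgraph r C n) (S : {set 'I_n}) :
    cgraph r C #|S| :=
  pullback (@enum_val_inj _ (mem S)) G.

Record property (r : nat) (C : finType) := Property {
  property_set :> forall n, {set cgraph r C n};
  property_relabel : forall n (s : 'S_n) (G : cgraph r C n),
    (relabel s G \in property_set n) = (G \in property_set n)
}.

(* The probability that the subgraph of G induced on a uniformly random
   q-element set of vertices belongs to P; meaningful for q <= n only. *)
Definition sample_prob (R : realType) r C n (q : nat) (G : cgraph r C n)
    (P : property r C) : R :=
  #|[set S : {set 'I_n} | (#|S| == q) && (induced G S \in P #|S|)]|%:R
  / #|[set S : {set 'I_n} | #|S| == q]|%:R.

Definition edit_dist r C n (G H : cgraph r C n) : nat :=
  #|[set e | G e != H e]|.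

(* If P has no member on n vertices, every G on n vertices is far from P. *)
Definition far (R : realType) r C n (eps : R) (G : cgraph r C n)
    (P : property r C) : Prop :=
  forall H : cgraph r C n, H \in P n ->
    eps * n%:R ^+ r <= (edit_dist G H)%:R.

Definition testable (R : realType) r C (P : property r C) : Prop :=
  exists P' : property r C,
    (forall (n : nat) (G : cgraph r C n) (q : nat),
       G \in P n -> (1 <= q <= n)%N -> 2 / 3 <= sample_prob R q G P') /\
    (forall eps : R, 0 < eps ->
       exists2 q0 : nat, (1 <= q0)%N &
         forall (q n : nat) (G : cgraph r C n),
           (q0 <= q)%N -> (q <= n)%N -> far eps G P ->
           sample_prob R q G P' <= 1 / 3).

Definition discolor r k n (G : cgraph r (bool * 'I_k)%type n) : rgraph r n :=
  [ffun e => (G e).1].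

Definition nondet_testable (R : realType) r (P : property r bool) : Prop :=
  exists2 k : nat, (1 <= k)%N &
    exists2 Q : property r (bool * 'I_k)%type,
      testable R Q & forall n, [set discolor G | G in Q n] = P n.

(* Main.v *)
Require Import Defs.
From mathcomp Require Import all_boot all_order all_algebra reals.
From mathcomp Require Import all_fingroup lra ring zify.
From mathcomp Require boolp.

(** A sample F is accepted when it has a coloring on which the witness test, at a scale m
    growing slowly with the size of F, accepts with probability at least 1/2. Members of
    the property are accepted because sampling statistics concentrate. For the converse, a
    coloring of a random sample F of G has to be lifted to a coloring of G with almost the
    same statistics on m vertices.

    Place random anchor vertices in G and fix thresholds th 0 >= ... >= th m = 0. In order
    of increasing cardinality, draw for every vertex set A the colors of all sets A u Q, Q
    among the first th |A| anchors, with their conditional law in F given the colors drawn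
    at the proper subsets of A and the uncolored structure on A and the first t anchors.
    In F, conditioning on the whole past of A instead of this local information is, by
    exchangeability, the same as conditioning on more anchors. The resulting L1 error is
    controlled by an increment of the energy (the mean square of the conditional
    probabilities), which is monotone in the number of anchors and at most 1; so the
    pigeonhole principle provides thresholds for which all errors are small. The random
    coloring of G then has the statistics of F in expectation, and some coloring of G does
    at least as well. *)

Set Implicit Arguments.
Unset Strict Implicit.
Unset Printing Implicit Defensive.

Import Order.TTheory GRing.Theory Num.Theory.
Local Open Scope ring_scope.

(** * Uniform averages *)

Section Average.
Variable R : realFieldType.
Implicit Types T : finType.

Definition avg T (f : T -> R) : R := (\sum_x f x) / #|T|%:R.

Lemma eq_avg T (f g : T -> R) : f =1 g -> avg f = avg g.
Proof. by move=> fg; rewrite /avg (eq_bigr g). Qed.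

Lemma ler_avg T (f g : T -> R) : (forall x, f x <= g x) -> avg f <= avg g.
Proof. by move=> fg; rewrite ler_wpM2r ?invr_ge0 ?ler0n// ler_sum. Qed.

Lemma avgD T (f g : T -> R) : avg (fun x => f x + g x) = avg f + avg g.
Proof. by rewrite /avg big_split mulrDl. Qed.

Lemma avgZ T a (f : T -> R) : avg (fun x => a * f x) = a * avg f.
Proof. by rewrite /avg -mulr_sumr mulrA. Qed.

Lemma avgB T (f g : T -> R) : avg (fun x => f x - g x) = avg f - avg g.
Proof. by rewrite /avg sumrB mulrBl. Qed.

Lemma avg_sum (I : finType) T (f : I -> T -> R) :
  avg (fun x => \sum_i f i x) = \sum_i avg (f i).
Proof. by rewrite /avg exchange_big /= mulr_suml. Qed.

Lemma avg_cst T (c : R) : (0 < #|T|)%N -> avg (fun _ : T => c) = c.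
Proof.
by move=> T0; rewrite /avg sumr_const -[c *+ _]mulr_natr mulfK// pnatr_eq0 -lt0n.
Qed.

Lemma avg_ge0 T (f : T -> R) : (forall x, 0 <= f x) -> 0 <= avg f.
Proof. by move=> f0; rewrite divr_ge0 ?ler0n// sumr_ge0. Qed.

Lemma avg_le1 T (f : T -> R) : (forall x, f x <= 1) -> avg f <= 1.
Proof.
move=> f1; rewrite /avg; case: (posnP #|T|) => [->|T0].
  by rewrite invr0 mulr0 ler01.
by rewrite -[leRHS](@avg_cst T 1)//; apply: ler_avg.
Qed.

Lemma ler_norm_avg T (f : T -> R) : `|avg f| <= avg (fun x => `|f x|).
Proof.
rewrite /avg normrM (ger0_norm (_ : 0 <= #|T|%:R^-1)) ?invr_ge0 ?ler0n//.
by rewrite ler_wpM2r ?invr_ge0 ?ler0n// ler_norm_sum.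
Qed.

Lemma avg_le_ex T (f : T -> R) : (0 < #|T|)%N -> exists x, avg f <= f x.
Proof.
move=> T0; case/card_gt0P: (T0) => x0 _.
exists [arg max_(x > x0) f x]%O; case: arg_maxP => // x _ fx.
by rewrite -[leRHS](@avg_cst T)//; apply: ler_avg => y; exact: fx.
Qed.

(** A function on [J] extends along the injection [p] by free choices at the [#|J'| - #|J|] points
    outside the image. *)
Lemma sum_ffun_comp (J J' U : finType) (p : J -> J') (phi : {ffun J -> U} -> R) :
    injective p ->
  \sum_(w : {ffun J' -> U}) phi [ffun i => w (p i)] =
    (#|U| ^ (#|J'| - #|J|))%:R * \sum_w phi w.
Proof.
move=> p_inj; rewrite (partition_big (fun w : {ffun J' -> U} => [ffun i => w (p i)]) predT) //=.
rewrite mulr_sumr; apply: eq_bigr => v _.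
rewrite (eq_bigr (fun=> phi v)) => [|w /eqP-> //].
rewrite sumr_const mulr_natl; congr (_ *+ _).
pose Fm (j : J') : pred U :=
  if [pick i | p i == j] is Some i then pred1 (v i) else predT.
rewrite (_ : #|_| = #|family Fm|); last first.
  apply: eq_card => w; rewrite -topredE /=; apply/(@eqP {ffun J -> U})/familyP => [e j|e].
    rewrite /Fm; case: pickP => [i /eqP <-|_] //.
    by rewrite -e ffunE inE.
  apply/ffunP => i; rewrite ffunE; move: (e (p i)); rewrite /Fm.
  case: pickP => [i' /eqP/p_inj ->|/(_ i)]; last by rewrite eqxx.
  by rewrite inE => /eqP.
rewrite card_family foldrE big_map big_enum /=.
rewrite (bigID (mem (codom p))) /= big1 => [|j /codomP[i ->]]; last first.
  rewrite /Fm; case: pickP => [i' _|/(_ i)]; last by rewrite eqxx.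
  exact: card1.
rewrite mul1n (eq_bigr (fun=> #|U|)) => [|j jp]; last first.
  rewrite /Fm; case: pickP => [i' /eqP e|_] //.
  by rewrite -e codom_f in jp.
rewrite prod_nat_const; congr (_ ^ _)%N.
have := cardC (mem (codom p)); rewrite card_codom// => <-.
by rewrite addKn; apply: eq_card => j.
Qed.

Lemma avg_ffun_comp (J J' U : finType) (p : J -> J') (phi : {ffun J -> U} -> R) :
    injective p -> (0 < #|U|)%N ->
  avg (fun w : {ffun J' -> U} => phi [ffun i => w (p i)]) = avg phi.
Proof.
move=> p_inj U0; rewrite /avg sum_ffun_comp// !card_ffun.
have le : (#|J| <= #|J'|)%N by exact: leq_card p_inj.
rewrite -{2}(subnKC le) expnD natrM.
have u k : (#|U| ^ k)%:R != 0 :> R by rewrite pnatr_eq0 -lt0n expn_gt0 U0.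
by field; rewrite !u.
Qed.

(** The denominator counts the injective maps; if there are none, the value is 0. *)
Definition avg_inj (J V : finType) (b : {ffun J -> V} -> R) : R :=
  (\sum_(w : {ffun J -> V} | injectiveb w) b w) / (#|V| ^_ #|J|)%:R.

(** Birthday bound, by induction: the ratio gains a factor [1 - k/n], and the product of [1 - k^2/n]
    and [1 - k/n] is at least [1 - (k+1)^2/n]. *)
Lemma ffact_lower n k : (0 < n)%N -> (k <= n)%N ->
  1 - k%:R ^+ 2 / n%:R <= (n ^_ k)%:R / n%:R ^+ k :> R.
Proof.
move=> n0; have n0' : 0 < n%:R :> R by rewrite ltr0n.
elim: k => [|k IH] kn; first by rewrite ffactn0 expr0 expr0n /= mul0r subr0 divr1.
have {}IH := IH (ltnW kn).
rewrite ffactnSr natrM natrB ?(ltnW kn)// [n%:R ^+ k.+1]exprSr invfM mulrACA.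
have k1 : 0 <= 1 - k%:R / n%:R :> R.
  by rewrite subr_ge0 ler_pdivrMr// mul1r ler_nat ltnW.
have -> : (n%:R - k%:R) / n%:R = 1 - k%:R / n%:R :> R by field; rewrite gt_eqF.
apply: le_trans (ler_wpM2r k1 IH).
have k0 : 0 <= k%:R :> R by exact: ler0n.
have x0 : 0 <= n%:R^-1 :> R by rewrite invr_ge0 ltW.
rewrite -natr1; set x := n%:R^-1 in x0 *; set y := k%:R in k0 *.
have y3 : 0 <= y * y * y * x * x by rewrite !mulr_ge0.
have yx : 0 <= y * x by rewrite mulr_ge0.
nra.
Qed.

(** Let [N] of the [D] maps be injective, and let [s], [t] be the sums of [b] over the injective and
    the other maps. The difference is [t / D] minus the product of [1 - N / D] and [s / N], and both
    of these lie between 0 and [1 - N / D]. *)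
Lemma avg_avg_inj (J V : finType) (b : {ffun J -> V} -> R) :
  (0 < #|V|)%N -> (forall w, 0 <= b w <= 1) ->
  `|avg b - avg_inj b| <= #|J|%:R ^+ 2 / #|V|%:R.
Proof.
move=> V0 b01.
have V0' : 0 < #|V|%:R :> R by rewrite ltr0n.
have b0 w : 0 <= b w by case/andP: (b01 w).
have b1 w : b w <= 1 by case/andP: (b01 w).
have card_inj : #|[pred w : {ffun J -> V} | injectiveb w]| = #|V| ^_ #|J|.
  by rewrite -card_inj_ffuns; apply: eq_card => w; rewrite !inE.
set N := (#|V| ^_ #|J|)%:R : R.
have sN : \sum_(w : {ffun J -> V} | injectiveb w) (1 : R) = N.
  by rewrite sumr_const card_inj.
have s0 : 0 <= \sum_(w : {ffun J -> V} | injectiveb w) b w by exact: sumr_ge0.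
have s1 : \sum_(w : {ffun J -> V} | injectiveb w) b w <= N by rewrite -sN; exact: ler_sum.
have ai : 0 <= avg_inj b <= 1.
  rewrite /avg_inj -/N divr_ge0 ?ler0n//=.
  have [->|N0] := eqVneq N 0; first by rewrite invr0 mulr0 ler01.
  by rewrite ler_pdivrMr ?mul1r// lt_def N0 ler0n.
have a01 : 0 <= avg b <= 1 by rewrite avg_ge0//= avg_le1.
(* If [J] is larger than [V], the bound is at least 1, while both averages lie in [0, 1]. *)
have [JV|JV] := leqP #|J| #|V|; last first.
  have : 1 <= #|J|%:R ^+ 2 / #|V|%:R :> R.
    rewrite ler_pdivlMr// mul1r -natrX ler_nat.
    by rewrite (leq_trans (ltnW JV))// expnS leq_pmulr// expn1 (leq_trans V0)// ltnW.
  rewrite ler_norml; move: a01 ai; lra.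
have N0 : 0 < N by rewrite ltr0n ffact_gt0.
have := ffact_lower V0 JV; rewrite -[#|V|%:R ^+ _]natrX; set D := (#|V| ^ #|J|)%:R.
have D0 : 0 < D :> R by rewrite ltr0n expn_gt0 V0.
rewrite -/N => low.
have sD : \sum_(w : {ffun J -> V}) (1 : R) = D.
  by rewrite sumr_const card_ffun.
have sni : \sum_(w : {ffun J -> V} | ~~ injectiveb w) (1 : R) = D - N.
  rewrite -sD [X in X - N](bigID (fun w : {ffun J -> V} => injectiveb w)) /= sN.
  by rewrite addrAC subrr add0r.
have t1 : \sum_(w : {ffun J -> V} | ~~ injectiveb w) b w <= D - N by rewrite -sni; exact: ler_sum.
have t0 : 0 <= \sum_(w : {ffun J -> V} | ~~ injectiveb w) b w by exact: sumr_ge0.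
have -> : avg b = (\sum_(w : {ffun J -> V} | injectiveb w) b w +
                   \sum_(w : {ffun J -> V} | ~~ injectiveb w) b w) / D.
  by rewrite /avg (bigID (fun w : {ffun J -> V} => injectiveb w)) card_ffun.
move: s0 s1 t0 t1 (ai); rewrite /avg_inj -/N.
move: (\sum_(w : {ffun J -> V} | injectiveb w) b w)
      (\sum_(w : {ffun J -> V} | ~~ injectiveb w) b w) => s t s0 s1 t0 t1 /andP[u0 u1].
have -> : (s + t) / D - s / N = t / D - (1 - N / D) * (s / N).
  by field; rewrite !gt_eqF.
have tD : 0 <= t / D <= 1 - N / D.
  rewrite divr_ge0 ?(ltW D0)//= (_ : 1 - _ = (D - N) / D); last by field; rewrite gt_eqF.
  by rewrite ler_wpM2r// invr_ge0 ltW.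
move: u0 u1 low tD; set u := s / N; set v := N / D; set z := t / D.
move=> u0 u1 low /andP[z0 z1].
rewrite ler_norml; apply/andP; split; nra.
Qed.

End Average.

(** * Conditional expectation, energy and scales *)

Section CondExp.
Variables (R : realFieldType) (Om : finType).

Definition condexp (T : eqType) (Y : Om -> T) (f : Om -> R) (w : Om) : R :=
  (\sum_(v | Y v == Y w) f v) / #|[pred v | Y v == Y w]|%:R.

(** The mean conditional probability, given [Y], of the value that [Z] actually takes. This equals
    the usual sum of mean squares ([energy_sumsq]), but refers only to coincidences of values. *)
Definition energy (T T' : eqType) (Y : Om -> T) (Z : Om -> T') : R :=
  avg (fun w => condexp Y (fun v => (Z v == Z w)%:R) w).

Lemma condexp_measurable (T : eqType) (Y : Om -> T) f v w :
  Y v = Y w -> condexp Y f v = condexp Y f w.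
Proof. by rewrite /condexp => ->. Qed.

Lemma condexp_card_gt0 (T : eqType) (Y : Om -> T) w :
  0 < #|[pred v | Y v == Y w]|%:R :> R.
Proof. by rewrite ltr0n; apply/card_gt0P; exists w; rewrite inE eqxx. Qed.

(** After exchanging the sums, each [v] receives the inverse fibre size once from every point of its
    own fibre, on which [g] is constant. *)
Lemma sum_condexp (T : eqType) (Y : Om -> T) f g :
  (forall v w, Y v = Y w -> g v = g w) ->
  \sum_w condexp Y f w * g w = \sum_w f w * g w.
Proof.
move=> gY.
under eq_bigr do rewrite /condexp -mulrA mulr_suml big_mkcond /=.
rewrite exchange_big /=; apply: eq_bigr => v _.
rewrite -big_mkcond /= -mulr_sumr; congr (_ * _).
rewrite (eq_bigr (fun=> (#|[pred u | Y u == Y v]|%:R^-1 * g v))); last first.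
  by move=> w /eqP e; rewrite e (gY _ _ e).
rewrite sumr_const -mulrnAl -mulr_natl.
rewrite (_ : #|_| = #|[pred u | Y u == Y v]|); last first.
  by apply: eq_card => w; rewrite !inE; exact: eq_sym.
by rewrite mulfV ?mul1r// gt_eqF// condexp_card_gt0.
Qed.

Lemma condexp_ind01 (T T' : eqType) (Y : Om -> T) (Z : Om -> T') z w :
  0 <= condexp Y (fun v => (Z v == z)%:R) w <= 1.
Proof.
rewrite /condexp divr_ge0 ?sumr_ge0 ?ler0n//=.
rewrite ler_pdivrMr ?condexp_card_gt0// mul1r -sumr_const ler_sum// => v _.
by case: (_ == _); rewrite ?ler01 ?lexx.
Qed.

Lemma energy01 (T T' : eqType) (Y : Om -> T) (Z : Om -> T') :
  0 <= energy Y Z <= 1.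
Proof.
apply/andP; split.
  by apply: avg_ge0 => w; case/andP: (condexp_ind01 Y Z (Z w) w).
by apply: avg_le1 => w; case/andP: (condexp_ind01 Y Z (Z w) w).
Qed.

(** One factor of each square is averaged out by [sum_condexp]; the indicators then leave only the
    term [z = Z w]. *)
Lemma energy_sumsq (T : eqType) (T' : finType) (Y : Om -> T) (Z : Om -> T') :
  energy Y Z = \sum_z avg (fun w => condexp Y (fun v => (Z v == z)%:R) w ^+ 2).
Proof.
rewrite -avg_sum /energy /avg; congr (_ / _).
rewrite [RHS]exchange_big /=.
under [RHS]eq_bigr => z _.
  under eq_bigr do rewrite expr2.
  rewrite sum_condexp; last by move=> v w; exact: condexp_measurable.
  over.
rewrite [RHS]exchange_big /=; apply: eq_bigr => w _.
rewrite (bigD1 (Z w)) //= eqxx mul1r big1 ?addr0// => z zw.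
by rewrite eq_sym (negbTE zw) mul0r.
Qed.

(** Only the partitions into fibres enter the energy. *)
Lemma energy_eq (T1 T2 T3 T4 : eqType) (Y : Om -> T1) (Y' : Om -> T2)
    (Z : Om -> T3) (Z' : Om -> T4) :
  (forall v w, (Y v == Y w) = (Y' v == Y' w)) ->
  (forall v w, (Z v == Z w) = (Z' v == Z' w)) -> energy Y Z = energy Y' Z'.
Proof.
move=> YY' ZZ'; apply: eq_avg => w; rewrite /condexp.
congr (_ / _%:R); last by apply: eq_card => v; rewrite !inE YY'.
by apply: eq_big => [v|v _]; rewrite ?YY' ?ZZ'.
Qed.

(** As [Yp] determines [Ym], the two conditional expectations have the same inner product with
    [condexp Ym f]. *)
Lemma condexp_pythagoras (T1 T2 : eqType) (Yp : Om -> T1) (Ym : Om -> T2) f :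
  (forall v w, Yp v = Yp w -> Ym v = Ym w) ->
  avg (fun w => (condexp Yp f w - condexp Ym f w) ^+ 2) =
  avg (fun w => condexp Yp f w ^+ 2) - avg (fun w => condexp Ym f w ^+ 2).
Proof.
move=> pm; have mm v w : Ym v = Ym w -> condexp Ym f v = condexp Ym f w.
  exact: condexp_measurable.
have cross : \sum_w condexp Yp f w * condexp Ym f w =
    \sum_w condexp Ym f w * condexp Ym f w.
  by rewrite !sum_condexp// => v w /pm; exact: mm.
rewrite /avg -mulrBl; congr (_ / _).
rewrite (eq_bigr (fun w => (condexp Yp f w ^+ 2 + condexp Ym f w * condexp Ym f w) -
   2 * (condexp Yp f w * condexp Ym f w))); last by move=> w _; ring.
rewrite sumrB big_split /= -mulr_sumr cross.
rewrite [X in _ = _ - X](eq_bigr (fun w => condexp Ym f w * condexp Ym f w)) //.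
by rewrite mulr_natl mulr2n opprD addrA addrK.
Qed.

Lemma energy_le (T1 T2 : eqType) (T' : finType) (Yp : Om -> T1) (Ym : Om -> T2)
    (Z : Om -> T') :
  (forall v w, Yp v = Yp w -> Ym v = Ym w) -> energy Ym Z <= energy Yp Z.
Proof.
move=> pm; rewrite !energy_sumsq; apply: ler_sum => z _.
rewrite -subr_ge0 -condexp_pythagoras//.
by apply: avg_ge0 => w; exact: sqr_ge0.
Qed.

(** Each deviation satisfies [|d| <= d^2 / (2 eta) + eta / 2] and vanishes for [z] outside [D]. By
    Pythagoras the mean squares add up to the energy increment, which contributes at most
    [eta / 2]. *)
Lemma condexp_l1 (T1 T2 : eqType) (T' : finType) (Yp : Om -> T1)
    (Ym : Om -> T2) (Z : Om -> T') (D : {pred T'}) (eta : R) :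
    (forall v w, Yp v = Yp w -> Ym v = Ym w) -> (forall w, Z w \in D) ->
    0 < eta -> energy Yp Z - energy Ym Z <= eta ^+ 2 ->
  avg (fun w => \sum_z `|condexp Yp (fun v => (Z v == z)%:R) w -
                         condexp Ym (fun v => (Z v == z)%:R) w|) <= eta * #|D|%:R.
Proof.
move=> pm ZD eta0 en.
have [Om0|Om0] := posnP #|Om|.
  by rewrite /avg Om0 invr0 mulr0 mulr_ge0 ?ler0n ?(ltW eta0).
have D0 : 1 <= #|D|%:R :> R.
  case/card_gt0P: Om0 => w _; rewrite ler1n.
  by apply/card_gt0P; exists (Z w).
pose d z w := condexp Yp (fun v => (Z v == z)%:R) w -
              condexp Ym (fun v => (Z v == z)%:R) w.
apply: (@le_trans _ _ (avg (fun w => \sum_z (d z w ^+ 2 * (2 * eta)^-1) +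
    #|D|%:R * (eta / 2)))).
  apply: ler_avg => w.
  have -> : #|D|%:R * (eta / 2) = \sum_z (if z \in D then eta / 2 else 0).
    by rewrite -big_mkcond sumr_const mulr_natl.
  rewrite -big_split; apply: ler_sum => z _ /=; rewrite -/(d z w).
  case: ifP => [_|zD].
    have : 0 <= (`|d z w| - eta) ^+ 2 * (2 * eta)^-1.
      by rewrite mulr_ge0 ?sqr_ge0// invr_ge0 mulr_ge0 ?ler0n ?(ltW eta0).
    rewrite sqrrB real_normK ?num_real// (_ : _ * (2 * eta)^-1 =
      d z w ^+ 2 * (2 * eta)^-1 + eta / 2 - `|d z w|); first by lra.
    by field; rewrite gt_eqF.
  have z0 v : (Z v == z) = false.
    by apply/eqP => e; rewrite -e ZD in zD.
  rewrite /d /condexp !big1 ?mul0r ?subrr ?normr0 ?expr0n ?mul0r ?addr0//.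
    by move=> v _; rewrite z0.
  by move=> v _; rewrite z0.
rewrite avgD avg_cst// avg_sum.
rewrite (eq_bigr (fun z => (2 * eta)^-1 * avg (fun w => d z w ^+ 2))); last first.
  by move=> z _; rewrite -avgZ; apply: eq_avg => w; rewrite mulrC.
rewrite -mulr_sumr (_ : \sum_z _ = energy Yp Z - energy Ym Z); last first.
  by rewrite !energy_sumsq -sumrB; apply: eq_bigr => z _; exact: condexp_pythagoras.
have : (2 * eta)^-1 * (energy Yp Z - energy Ym Z) <= (2 * eta)^-1 * eta ^+ 2.
  by rewrite ler_wpM2l// invr_ge0 mulr_ge0 ?ler0n ?(ltW eta0).
rewrite (_ : (2 * eta)^-1 * eta ^+ 2 = eta / 2); last by field; rewrite gt_eqF.
nra.
Qed.

End CondExp.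

Lemma energy_bij (R : realFieldType) (Om Om' : finType) (T T' : eqType) (h : Om -> Om')
    (Y : Om' -> T) (Z : Om' -> T') : bijective h ->
  energy R (Y \o h) (Z \o h) = energy R Y Z.
Proof.
move=> bh; rewrite /energy /avg (reindex h) /=; last exact: onW_bij.
rewrite (bij_eq_card bh); congr (_ / _); apply: eq_bigr => w _.
rewrite /condexp [in RHS](reindex h) /=; last exact: onW_bij.
congr (_ / _%:R).
rewrite -(card_image (bij_inj bh)); apply: eq_card => v.
apply/imageP/idP => [[u uw ->//]|vw].
by case: bh => g hK gK; exists (g v); rewrite ?inE ?gK.
Qed.

(** * Choice of scales by the pigeonhole principle *)

Section Scales.
Variables (R : realFieldType) (delta : nat -> R) (L : nat -> nat) (w : nat).
Hypothesis dL : forall u, 1 < (L u)%:R * delta u.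

(** Room needed for [k] further scales after [u], with a margin [w]. The candidates for the next
    scale are iterates of the bound for [k'], so that all remaining scales fit between two
    consecutive candidates. *)
Fixpoint scale_bound (k u : nat) : nat :=
  if k is k'.+1 then iter (L u) (scale_bound k') u else (u + w)%N.

Lemma scale_bound_ge k u : (u + w <= scale_bound k u)%N.
Proof.
elim: k u => [//|k IH] u /=.
have : (0 < L u)%N.
  by case: (L u) (dL u) => //; rewrite mul0r ltr10.
case: (L u) => // l _ /=.
apply: leq_trans (IH _); rewrite leq_add2r.
by elim: l => //= l IHl; rewrite (leq_trans IHl)// (leq_trans _ (IH _))// leq_addr.
Qed.

(* Pigeonhole, applied to the scales obtained by iterating the bound for the
   remaining levels: e 0 u is bounded, so it is nearly constant between two
   consecutive scales, and all later choices are made between these two. *)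
Lemma scales k u (e : nat -> nat -> nat -> R) :
    (forall i v s s', (s <= s')%N -> e i v s <= e i v s') ->
    (forall i v s, 0 <= e i v s <= 1) ->
  exists us : nat -> nat,
    [/\ us 0%N = u, forall i, (i < k)%N -> (us i <= us i.+1)%N,
        (us k + w <= scale_bound k u)%N &
        forall i, (i < k)%N ->
          e i (us i) (us k + w)%N - e i (us i) (us i.+1) <= delta (us i)].
Proof.
elim: k u e => [|k IH] u e e_le e01.
  by exists (fun=> u); split.
pose s l := iter l (scale_bound k) u.
have sS l : (s l <= s l.+1)%N.
  by rewrite /= (leq_trans _ (scale_bound_ge _ _))// leq_addr.
have [l lL ls] : exists2 l, (l < L u)%N & e 0%N u (s l.+1) - e 0%N u (s l) <= delta u.
  have [//|n0] : (exists2 l, (l < L u)%N & e 0%N u (s l.+1) - e 0%N u (s l) <= delta u)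
      \/ (L u)%:R * delta u <= e 0%N u (s (L u)) - e 0%N u (s 0%N).
    elim: (L u) => [|n [[l ln el]|IHn]]; first by right; rewrite mul0r subrr.
      by left; exists l => //; rewrite ltnW.
    have [small|big] := lerP (e 0%N u (s n.+1) - e 0%N u (s n)) (delta u).
      by left; exists n.
    by right; rewrite -natr1; lra.
  have := dL u; have /andP[] := e01 0%N u (s (L u)); have /andP[] := e01 0%N u (s 0%N).
  by lra.
(* The remaining scales start at [s l] and stay, with the margin, below [s l.+1]; by monotonicity
   the increment at level 0 is at most the small one just found. *)
have [us [us0 us_le us_k us_e]] := IH (s l) (fun i => e i.+1)
  (fun i => e_le i.+1) (fun i => e01 i.+1).
exists (fun i => if i is i'.+1 then us i' else u); split => //.
- case=> [_|i]; last exact: us_le.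
  by rewrite us0; elim: (l) => //= j IHj; rewrite (leq_trans IHj)//; exact: sS j.
- apply: leq_trans us_k _; rewrite -[scale_bound k (s l)]/(s l.+1).
  rewrite -[scale_bound k.+1 u]/(s (L u)).
  move: lL => /subnKC <-; elim: (_ - _)%N => [|j IHj]; first by rewrite addn0.
  by rewrite addnS; apply: leq_trans IHj _; exact: sS.
- case=> [_|i]; last exact: us_e.
  rewrite us0; apply: le_trans ls; rewrite lerD2r.
  exact: e_le.
Qed.

End Scales.

(** * Sequential sampling of labels *)

Definition upd (V K : finType) (zeta : {ffun {set V} -> K}) (A : {set V}) (z : K) :
  {ffun {set V} -> K} := [ffun B => if B == A then z else zeta B].

(** Lists in which no set contains a later one: they are free of repetitions and compatible with
    inclusion. *)
Definition topo (V : finType) : seq {set V} -> bool :=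
  pairwise (fun A B : {set V} => ~~ (B \subset A)).

Lemma topo_card (V : finType) (l : seq {set V}) :
  uniq l -> pairwise (fun A B : {set V} => #|A| <= #|B|)%N l -> topo l.
Proof.
move=> ul ll; have := conj ll ul => /andP; rewrite uniq_pairwise -pairwise_relI.
apply: sub_pairwise => A B /= /andP[AB neq]; apply: contra neq => sBA.
by rewrite eq_sym eqEcard sBA AB.
Qed.

Section Sampling.
Variables (R : realFieldType) (V K : finType).
Implicit Types (zeta : {ffun {set V} -> K}) (l : seq {set V}).
Variable kap : {set V} -> {ffun {set V} -> K} -> K -> R.

(** The expectation of [h] after the labels of the sets in [l] are redrawn in turn, starting from
    [zeta], where [kap A] gives the law of the new label of [A] in terms of the current labels. *)
Fixpoint seqsample l zeta (h : {ffun {set V} -> K} -> R) : R :=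
  if l is A :: l' then \sum_z kap A zeta z * seqsample l' (upd zeta A z) h
  else h zeta.

Lemma seqsample_avg (T : finType) l zeta (h : T -> {ffun {set V} -> K} -> R) :
  seqsample l zeta (fun x => avg (fun y => h y x)) = avg (fun y => seqsample l zeta (h y)).
Proof.
elim: l zeta => //= A l IH zeta.
by rewrite avg_sum; apply: eq_bigr => z _; rewrite IH avgZ.
Qed.

Hypothesis kap0 : forall A zeta z, 0 <= kap A zeta z.
Hypothesis kap1 : forall A zeta, \sum_z kap A zeta z = 1.

(** Each draw is a convex combination, so some label does at least as well as the average. *)
Lemma seqsample_le_ex l zeta h : exists zeta', seqsample l zeta h <= h zeta'.
Proof.
elim: l zeta => [|A l IH] zeta /=; first by exists zeta.
have [z zP] : exists z, \sum_z kap A zeta z * seqsample l (upd zeta A z) h <=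
    seqsample l (upd zeta A z) h.
  pose F z := seqsample l (upd zeta A z) h.
  have [z0 _|K0] := pickP K; last first.
    by have := kap1 A zeta; rewrite big_pred0// => /esym/eqP; rewrite oner_eq0.
  exists [arg max_(z > z0) F z]%O; case: arg_maxP => // z _ Fz.
  rewrite -/(F z) -[leRHS]mul1r -(kap1 A zeta) mulr_suml.
  by apply: ler_sum => z' _; apply: ler_wpM2l => //; exact: Fz.
by have [zeta' h'] := IH (upd zeta A z); exists zeta'; exact: le_trans zP h'.
Qed.

Lemma seqsample01 l zeta h : (forall x, 0 <= h x <= 1) -> 0 <= seqsample l zeta h <= 1.
Proof.
move=> h01; elim: l zeta => //= A l IH zeta; apply/andP; split.
  by apply: sumr_ge0 => z _; rewrite mulr_ge0//; case/andP: (IH (upd zeta A z)).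
rewrite -(kap1 A zeta); apply: ler_sum => z _.
by rewrite ler_piMr//; case/andP: (IH (upd zeta A z)).
Qed.

Hypothesis kap_local : forall (A : {set V}) zeta zeta' z,
  (forall B : {set V}, B \proper A -> zeta B = zeta' B) ->
  kap A zeta z = kap A zeta' z.

(** In a list satisfying [topo], the proper subsets of [A] keep their labels once [A] is drawn, so
    by locality the kernel may be evaluated at the final labelling. *)
Lemma seqsample_prod l zeta0 h : topo l ->
  seqsample l zeta0 h =
  \sum_(zeta : {ffun {set V} -> K} | [forall B, (B \notin l) ==> (zeta B == zeta0 B)])
    (\prod_(A <- l) kap A zeta (zeta A)) * h zeta.
Proof.
elim: l zeta0 => [|A l IH] zeta0.
  move=> _; rewrite (big_pred1 zeta0) ?big_nil ?mul1r// => zeta /=.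
  apply/forallP/(@eqP {ffun {set V} -> K}) => [e|-> B]; last exact/eqP.
  by apply/ffunP => B; exact/eqP/e.
rewrite /topo /= -/(topo l) => /andP[/allP/= Al tl].
have AnL : A \notin l by apply/negP => /Al; rewrite subxx.
rewrite [RHS](partition_big (fun zeta : {ffun {set V} -> K} => zeta A) predT)//=.
apply: eq_bigr => z _; rewrite IH// mulr_sumr.
apply: eq_big => [zeta|zeta].
  apply/forallP/andP => [e|[/forallP e /eqP ez] B].
    have eA : zeta A = z by move: (e A); rewrite AnL ffunE eqxx => /eqP.
    split; last by rewrite eA.
    apply/forallP => B; apply/implyP; rewrite inE negb_or => /andP[BA Bl].
    by move: (e B); rewrite Bl ffunE (negbTE BA).
  apply/implyP => Bl; rewrite ffunE; have [->|BA] := eqVneq B A; first by rewrite ez.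
  by move: (e B); rewrite inE negb_or BA Bl.
move=> /forallP e; rewrite big_cons mulrA; congr (_ * _ * _).
have -> : z = zeta A by move: (e A); rewrite AnL ffunE eqxx => /eqP.
apply: kap_local => B BA.
have Bl : B \notin l by apply/negP => /Al; rewrite (proper_sub BA).
move: (e B); rewrite Bl ffunE; have [BeA|_ /eqP //] := eqVneq B A.
by rewrite BeA properxx in BA.
Qed.

Lemma topo_uniq l : topo l -> uniq l.
Proof.
rewrite uniq_pairwise; apply: sub_pairwise => A B /=.
by apply: contraNneq => ->; rewrite subxx.
Qed.

(** The product formula depends neither on the order of the draws nor on overwritten initial
    labels. *)
Lemma seqsample_full l l' zeta zeta' h :
  topo l -> topo l' -> (forall A, A \in l) -> (forall A, A \in l') ->
  seqsample l zeta h = seqsample l' zeta' h.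
Proof.
move=> tl tl' al al'; rewrite !seqsample_prod//; apply: eq_big => [x|x _].
  by apply/forallP/forallP => _ B; rewrite ?al ?al'.
congr (_ * _); apply: perm_big; apply: uniq_perm; rewrite ?topo_uniq// => A.
by rewrite al al'.
Qed.

Lemma seqsample_off l zeta zeta' h : topo l ->
  (forall B, B \notin l -> zeta B = zeta' B) ->
  seqsample l zeta h = seqsample l zeta' h.
Proof.
move=> tl e; rewrite !seqsample_prod//; apply: eq_bigl => x.
apply/forallP/forallP => xz B; apply/implyP => Bl.
  by rewrite -e//; move: (xz B); rewrite Bl.
by rewrite e//; move: (xz B); rewrite Bl.
Qed.

End Sampling.

(** * Sequential sampling along an injection of vertices *)

Section Transport.
Variables (R : realFieldType) (V V' K : finType) (y : V -> V').
Hypothesis y_inj : injective y.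
Variable kap : {set V} -> {ffun {set V} -> K} -> K -> R.
Variable kap' : {set V'} -> {ffun {set V'} -> K} -> K -> R.

Definition restr (zeta : {ffun {set V'} -> K}) : {ffun {set V} -> K} :=
  [ffun B : {set V} => zeta (y @: B)].

Hypothesis kap'E : forall (A : {set V}) zeta z, kap' (y @: A) zeta z = kap A (restr zeta) z.
Hypothesis kap'1 : forall A zeta, \sum_z kap' A zeta z = 1.

Definition restr_seq (l : seq {set V'}) : seq {set V} :=
  [seq y @^-1: (A : {set V'}) | A : {set V'} <- l & A \subset y @: setT].

Lemma imset_preimK (A : {set V'}) : A \subset y @: setT -> y @: (y @^-1: A) = A.
Proof.
move=> /subsetP sA; apply/setP => v; apply/imsetP/idP => [[x xA ->]|vA].
  by rewrite inE in xA.
by have /imsetP[x _ e] := sA _ vA; exists x => //; rewrite inE -e.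
Qed.

Lemma preim_imsetK (A : {set V}) : y @^-1: (y @: A) = A.
Proof. by apply/setP => v; rewrite inE mem_imset. Qed.

Lemma topo_restr l : topo l -> topo (restr_seq l).
Proof.
rewrite /topo /restr_seq pairwise_map => tl.
have {tl} : pairwise (fun A B : {set V'} => ~~ (B \subset A))
    [seq A : {set V'} <- l | A \subset y @: setT].
  by apply: subseq_pairwise tl; exact: filter_subseq.
apply: (@sub_in_pairwise _ (fun A : {set V'} => A \subset y @: setT)); last exact: filter_all.
move=> A B /= sA sB; apply: contra => /(imsetS y).
by rewrite !imset_preimK.
Qed.

Lemma mem_restr_seq l (A : {set V}) : y @: A \in l -> A \in restr_seq l.
Proof.
move=> Al; apply/mapP; exists (y @: A); last by rewrite preim_imsetK.
by rewrite mem_filter Al andbT imsetS// subsetT.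
Qed.

(** Draws at sets inside the image of [y] follow [kap] by [kap'E]; draws at other sets do not affect
    the restricted labelling, and their weights sum to 1. *)
Lemma seqsample_restr l zeta h :
  seqsample kap' l zeta (fun x => h (restr x)) = seqsample kap (restr_seq l) (restr zeta) h.
Proof.
elim: l zeta => //= A l IH zeta; rewrite /restr_seq /=.
have [sA|nsA] := boolP (A \subset _) => /=; rewrite -/(restr_seq l).
  apply: eq_bigr => z _; rewrite IH -{1}(imset_preimK sA) kap'E; congr (_ * seqsample _ _ _ _).
  apply/ffunP => B; rewrite !ffunE; congr (if _ then _ else _).
  by rewrite -{1}(imset_preimK sA) (inj_eq (imset_inj y_inj)).
rewrite -[RHS]mul1r -(kap'1 A zeta) mulr_suml; apply: eq_bigr => z _.
rewrite IH; congr (_ * seqsample _ _ _ _).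
apply/ffunP => B; rewrite !ffunE; case: eqP => // e.
by rewrite -e imsetS ?subsetT in nsA.
Qed.

End Transport.

(** * Replacing true conditional laws by kernels *)

Section Hybrid.
Variables (R : realFieldType) (Om V K : finType) (k0 : K) (G : eqType).
Variables (g : Om -> G) (Z : Om -> {ffun {set V} -> K}).
Variable kap : G -> {set V} -> {ffun {set V} -> K} -> K -> R.
Hypothesis kap0 : forall c A zeta z, 0 <= kap c A zeta z.
Hypothesis kap1 : forall c A zeta, \sum_z kap c A zeta z = 1.
Hypothesis kap_local : forall c (A : {set V}) (zeta zeta' : {ffun {set V} -> K}) z,
  (forall B : {set V}, B \proper A -> zeta B = zeta' B) ->
  kap c A zeta z = kap c A zeta' z.
Variable h : G -> {ffun {set V} -> K} -> R.
Hypothesis h01 : forall c x, 0 <= h c x <= 1.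

(** When sets are processed by cardinality, every label fixed before that of [A] is recorded here;
    the others are masked by [k0]. *)
Definition past (A : {set V}) (w : Om) : G * {ffun {set V} -> K} :=
  (g w, [ffun B => if (B != A) && (#|B| <= #|A|)%N then Z w B else k0]).

Variable err : {set V} -> R.
Hypothesis errP : forall A,
  avg (fun w => \sum_z `|condexp (past A) (fun v => (Z v A == z)%:R) w -
                         kap (g w) A (Z w) z|) <= err A.

(* Replaces, one set at a time, the true conditional law of the label of [A] given the
   whole past by the kernel. *)
Lemma hybrid l : uniq l -> pairwise (fun A B : {set V} => #|A| <= #|B|)%N l ->
    (forall A B : {set V}, A \in l -> B \notin l -> #|B| <= #|A|)%N ->
  `|avg (fun w => seqsample (kap (g w)) l (Z w) (h (g w))) -
    avg (fun w => h (g w) (Z w))| <= \sum_(A <- l) err A.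
Proof.
elim: l => [|A l IH] /=; first by rewrite big_nil subrr normr0.
move=> /andP[Al ul] /andP[/allP/= Ale ll] past_le.
have tl := topo_card ul ll.
have {}IH := IH ul ll _; rewrite big_cons.
apply: le_trans (ler_distD (avg (fun w => seqsample (kap (g w)) l (Z w) (h (g w)))) _ _) _.
apply: lerD; last first.
  apply: IH => B C Bl Cl; have [->|CA] := eqVneq C A; first exact: Ale.
  by apply: past_le; rewrite inE ?Bl ?orbT// negb_or CA.
pose Phi w z := seqsample (kap (g w)) l (upd (Z w) A z) (h (g w)).
have Phi01 w z : 0 <= Phi w z <= 1 by exact: seqsample01.
(* All labels outside the past of [A] are overwritten, by [z] or by the draws along [l]. *)
have Phi_past z v w : past A v = past A w -> Phi v z = Phi w z.
  move=> [gvw /ffunP Zvw]; rewrite /Phi gvw; apply: (seqsample_off (@kap_local _)) => // B Bl.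
  rewrite !ffunE; have [//|BA] := eqVneq B A; have := Zvw B; rewrite !ffunE BA.
  by rewrite past_le// inE ?eqxx// negb_or BA.
(* Since [Phi] is a function of the past, the true label of [A] may be replaced by its conditional
   law. *)
have -> : avg (fun w => seqsample (kap (g w)) l (Z w) (h (g w))) =
    avg (fun w => \sum_z condexp (past A) (fun v => (Z v A == z)%:R) w * Phi w z).
  rewrite [RHS]avg_sum; under [RHS]eq_bigr => z _.
    rewrite /avg sum_condexp; last by move=> v w; exact: Phi_past.
    over.
  rewrite /avg -mulr_suml exchange_big /=; congr (_ / _); apply: eq_bigr => w _.
  rewrite (bigD1 (Z w A)) //= eqxx mul1r big1 ?addr0; last first.
    by move=> z zw; rewrite eq_sym (negbTE zw) mul0r.
  rewrite /Phi; congr seqsample; apply/ffunP => B; rewrite ffunE.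
  by case: eqP => // ->.
rewrite -avgB; apply: le_trans (ler_norm_avg _) (le_trans _ (errP A)).
apply: ler_avg => w; rewrite -sumrB; apply: le_trans (ler_norm_sum _ _ _) _.
apply: ler_sum => z _; rewrite -/(Phi w z) -mulrBl normrM distrC.
case/andP: (Phi01 w z) => p0 p1; rewrite (ger0_norm p0).
by rewrite ler_piMr.
Qed.

End Hybrid.

(** * Energy of sampled structures *)

Lemma perm_of_labels (J : finType) (T : eqType) (a b : J -> T) :
  perm_eq (map a (enum J)) (map b (enum J)) -> exists p : {perm J}, forall x, b (p x) = a x.
Proof.
pose ta := map_tuple a (enum_tuple J); pose tb := map_tuple b (enum_tuple J).
rewrite -[map a _]/(val ta) -[map b _]/(val tb) => /tuple_permP[p /val_inj e].
have inj : injective (fun x => enum_val (p (enum_rank x))).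
  by move=> x y /enum_val_inj/perm_inj/enum_rank_inj.
exists (perm inj) => x; rewrite permE.
have := congr1 (fun t => tnth t (enum_rank x)) e.
have enumT i : tnth (enum_tuple J) i = enum_val i.
  by rewrite (tnth_nth x) -[X in nth x X]/(enum J) -enum_val_nth.
by rewrite tnth_mktuple !tnth_map !enumT enum_rankK.
Qed.

Lemma map_const (A B : eqType) (f : A -> B) b s :
  {in s, forall x, f x = b} -> map f s = nseq (size s) b.
Proof.
elim: s => //= x s IH e; rewrite e ?inE ?eqxx// IH// => y ys.
by rewrite e// inE ys orbT.
Qed.

Lemma perm_enum_flag (J : finType) (A T S : {set J}) : T \subset S -> [disjoint A & S] ->
  perm_eq (enum J) (enum A ++ enum T ++ enum (S :\: T) ++ enum (~: (A :|: S))).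
Proof.
move=> TS AS.
have ucat (X : {set J}) s : uniq s -> {in s, forall x, x \notin X} -> uniq (enum X ++ s).
  move=> us sX; rewrite cat_uniq enum_uniq us andbT; apply/hasPn => x xs.
  by rewrite /= mem_enum; exact: sX.
apply: uniq_perm; rewrite ?enum_uniq//.
  apply: (ucat); first apply: (ucat); first apply: (ucat); rewrite ?enum_uniq//.
  - by move=> x; rewrite mem_enum !inE negb_or => /andP[_ /negbTE ->]; rewrite andbF.
  - move=> x; rewrite mem_cat !mem_enum !inE => /orP[/andP[]//|].
    by rewrite negb_or => /andP[_]; apply: contra => /(subsetP TS).
  - move=> x; rewrite !mem_cat !mem_enum !inE => xs; apply/negP => xA.
    have xnS := disjointFr AS xA.
    move: xs; rewrite xA xnS orbF andbF orbF => /(subsetP TS).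
    by rewrite xnS.
move=> x; rewrite !mem_cat !mem_enum !inE.
by case: (x \in A); case: (x \in T); case: (x \in S).
Qed.

Section Energy.
Variables (R : realFieldType) (U K : finType) (k0 : K).
Variables (F : {set U} -> bool) (c : {set U} -> K).

Section Labels.
Variable J : finType.
Implicit Types (A T S f : {set J}) (w : {ffun J -> U}).

(** For sets containing [A] only the uncolored structure is recorded: their colors are what [target]
    asks for. *)
Definition known S A w : {ffun {set J} -> bool * K} :=
  [ffun f : {set J} => if f \subset S :|: A then
     (F (w @: f), if A \subset f then k0 else c (w @: f)) else (false, k0)].

Definition target T A w : {ffun {set J} -> K} :=
  [ffun f : {set J} => if (A \subset f) && (f \subset T :|: A) then c (w @: f) else k0].

Definition energy_of A T S : R := energy R (known S A) (target T A).

Lemma knownS S S' A v w : S \subset S' ->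
  known S' A v = known S' A w -> known S A v = known S A w.
Proof.
move=> SS' /ffunP e; apply/ffunP => f; move: (e f); rewrite !ffunE.
by have [fS|//] := boolP (f \subset S :|: A); rewrite (subset_trans fS) ?setSU.
Qed.

Lemma energy_of_le A T S S' : S \subset S' -> energy_of A T S <= energy_of A T S'.
Proof. by move=> SS'; apply: energy_le => v w; exact: knownS. Qed.

Lemma energy_of_perm (p : {perm J}) A T S :
  energy_of (p @: A) (p @: T) (p @: S) = energy_of A T S.
Proof.
pose h w : {ffun J -> U} := [ffun j => w (p j)].
have hb : bijective h.
  exists (fun w => [ffun j => w (p^-1%g j)]) => w; apply/ffunP => j; rewrite !ffunE.
    by rewrite permKV.
  by rewrite permK.
have him w f : h w @: f = w @: (p @: f).
  by rewrite -imset_comp; apply: eq_imset => j; rewrite ffunE.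
have pS A1 A2 : (p @: A1 \subset p @: A2) = (A1 \subset A2).
  apply/idP/idP; last exact: imsetS.
  move=> /subsetP s; apply/subsetP => x xA; have := s (p x).
  by rewrite !(mem_imset _ _ perm_inj) => ->.
have pE f : exists f', f = p @: f'.
  exists (p^-1%g @: f); rewrite -imset_comp -[LHS]imset_id.
  by apply: eq_imset => j /=; rewrite permKV.
rewrite /energy_of -[RHS](energy_bij R _ _ hb); apply: energy_eq => v w.
  apply/eqP/eqP => /ffunP e; apply/ffunP => f.
    by move: (e (p @: f)); rewrite /= !ffunE -imsetU !pS !him.
  by have [f' ->] := pE f; move: (e f'); rewrite /= !ffunE -imsetU !pS !him.
apply/eqP/eqP => /ffunP e; apply/ffunP => f.
  by move: (e (p @: f)); rewrite /= !ffunE -imsetU !pS !him.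
by have [f' ->] := pE f; move: (e f'); rewrite /= !ffunE -imsetU !pS !him.
Qed.

(* Exchangeability of i.i.d. samples. *)
Lemma energy_of_card A T S A' T' S' :
    T \subset S -> [disjoint A & S] -> T' \subset S' -> [disjoint A' & S'] ->
    #|A| = #|A'| -> #|T| = #|T'| -> #|S| = #|S'| ->
  energy_of A T S = energy_of A' T' S'.
Proof.
move=> TS AS TS' AS' eA eT eS.
(* Each point is classified by its memberships; equal class sizes yield a permutation of [J]
   carrying one triple of sets to the other. *)
pose lab (A T S : {set J}) x := (x \in A, x \in T, x \in S).
have labE A1 T1 S1 : T1 \subset S1 -> [disjoint A1 & S1] ->
    perm_eq (map (lab A1 T1 S1) (enum J))
      (nseq #|A1| (true, false, false) ++ nseq #|T1| (false, true, true) ++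
       nseq (#|S1| - #|T1|) (false, false, true) ++
       nseq (#|J| - (#|A1| + #|S1|)) (false, false, false)).
  move=> TS1 AS1; apply: perm_trans (perm_map _ (perm_enum_flag TS1 AS1)) _.
  rewrite !map_cat /lab.
  rewrite (@map_const _ _ _ (true, false, false) (enum A1)); last first.
    move=> x; rewrite mem_enum => xA; rewrite xA (disjointFr AS1 xA).
    by case: (boolP (x \in T1)) => // /(subsetP TS1); rewrite (disjointFr AS1 xA).
  rewrite (@map_const _ _ _ (false, true, true) (enum T1)); last first.
    move=> x; rewrite mem_enum => xT; have xS := subsetP TS1 _ xT.
    by rewrite xT xS (disjointFl AS1 xS).
  rewrite (@map_const _ _ _ (false, false, true) (enum (S1 :\: T1))); last first.
    move=> x; rewrite mem_enum inE => /andP[/negbTE -> xS].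
    by rewrite xS (disjointFl AS1 xS).
  rewrite (@map_const _ _ _ (false, false, false) (enum (~: (A1 :|: S1)))); last first.
    move=> x; rewrite mem_enum !inE negb_or => /andP[/negbTE -> xS].
    by case: (boolP (x \in T1)) => [/(subsetP TS1)|_]; rewrite (negbTE xS).
  rewrite -!cardE cardsD (setIidPr TS1) [#|~: _|]cardsCs setCK cardsU.
  by rewrite (disjoint_setI0 AS1) cards0 subn0.
have [p pE] : exists p : {perm J}, forall x, lab A' T' S' (p x) = lab A T S x.
  apply: perm_of_labels; rewrite (permPl (labE _ _ _ TS AS)) perm_sym.
  by rewrite (permPl (labE _ _ _ TS' AS')) eA eT eS.
have im (X X' : {set J}) : (forall x, (p x \in X') = (x \in X)) -> p @: X = X'.
  move=> e; apply/setP => x; rewrite -(permKV p x) e.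
  by rewrite (mem_imset _ _ perm_inj).
rewrite -(energy_of_perm p) (im A A') ?(im T T') ?(im S S')// => x;
  by case: (pE x).
Qed.

End Labels.
End Energy.

(** * The sampling kernel *)

Section Sites.
Variable M : nat.

Definition anchors (s : nat) : {set 'I_M} := [set i : 'I_M | (i < s)%N].

Lemma anchorsS s s' : (s <= s')%N -> anchors s \subset anchors s'.
Proof. by move=> ss'; apply/subsetP => i; rewrite !inE => /leq_trans; apply. Qed.

Lemma card_anchors s : #|anchors s| = minn s M.
Proof.
have [sM|Ms] := ltnP s M.
  rewrite -sum1_card (eq_bigl (fun i : 'I_M => (i < s)%N)) => [|i]; last by rewrite inE.
  by rewrite -(big_ord_widen M (fun=> 1%N)) ?sum1_card ?card_ord// ltnW.
rewrite -[RHS](card_ord M); apply: eq_card => i; rewrite !inE.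
by rewrite (leq_trans (ltn_ord i)).
Qed.

(** The set A u Q inside the disjoint union of the anchor places and the vertices. *)
Definition site (V : finType) (Q : {set 'I_M}) (A : {set V}) : {set 'I_M + V} :=
  (inl @: Q) :|: (inr @: A).

Section SiteTheory.
Variable V : finType.
Implicit Types (Q S : {set 'I_M}) (A B : {set V}).

Lemma mem_site_inl Q A i : (inl i \in site Q A) = (i \in Q).
Proof.
rewrite !inE mem_imset; last by move=> ? ? [].
by case: imsetP => [[? ? //]|]; rewrite orbF.
Qed.

Lemma mem_site_inr Q A v : (inr v \in site Q A) = (v \in A).
Proof.
rewrite !inE mem_imset; last by move=> ? ? [].
by case: imsetP => [[? ? //]|].
Qed.

Lemma siteP (f : {set 'I_M + V}) : exists Q A, f = site Q A.
Proof.
exists (inl @^-1: f), (inr @^-1: f); apply/setP => -[i|v].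
  by rewrite mem_site_inl inE.
by rewrite mem_site_inr inE.
Qed.

Lemma subset_site Q A S B : (site Q A \subset site S B) = (Q \subset S) && (A \subset B).
Proof.
apply/subsetP/andP => [s|[/subsetP s1 /subsetP s2] [i|v]].
- split; apply/subsetP => x xX.
    by rewrite -(mem_site_inl S B) s// mem_site_inl.
  by rewrite -(mem_site_inr S B) s// mem_site_inr.
- by rewrite !mem_site_inl => /s1.
- by rewrite !mem_site_inr => /s2.
Qed.

Lemma siteU Q A S B : site Q A :|: site S B = site (Q :|: S) (A :|: B).
Proof. by rewrite /site !imsetU setUACA. Qed.

Lemma card_site Q A : #|site Q A| = (#|Q| + #|A|)%N.
Proof.
have inlI : injective (@inl 'I_M V) by move=> ? ? [].
have inrI : injective (@inr 'I_M V) by move=> ? ? [].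
rewrite /site cardsU disjoint_setI0 ?cards0 ?subn0 ?card_imset//.
apply/pred0P => x /=; apply/negP => /andP[/imsetP[i _ ->]].
by case/imsetP.
Qed.

Lemma disjoint_site Q A S B : [disjoint Q & S] -> [disjoint A & B] ->
  [disjoint site Q A & site S B].
Proof.
move=> QS AB; apply/pred0P => -[i|v] /=; apply/negP.
  by rewrite !mem_site_inl => /andP[/(disjointFr QS) ->].
by rewrite !mem_site_inr => /andP[/(disjointFr AB) ->].
Qed.

End SiteTheory.

Definition ext (V V' : finType) (y : V -> V') (s : 'I_M + V) : 'I_M + V' :=
  match s with inl i => inl i | inr v => inr (y v) end.

Lemma ext_inj (V V' : finType) (y : V -> V') : injective y -> injective (ext y).
Proof. by move=> y_inj [i|v] [j|u] //= [] => [->|/y_inj ->]. Qed.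

Lemma ext_site (V V' : finType) (y : V -> V') Q (A : {set V}) :
  ext y @: site Q A = site Q (y @: A).
Proof. by rewrite /site imsetU -!imset_comp. Qed.

End Sites.

Section Kernel.
Variables (R : realFieldType) (U K : finType) (k0 : K) (M : nat).
Variables (th : nat -> nat) (t : nat).
Variables (F : {set U} -> bool) (c : {set U} -> K).

(* [clab w A] lists the colors of the sets [A] u [Q], for [Q] among the first [th #|A|]
   anchors; outside of this range it is masked by the dummy color [k0]. Likewise
   [elab w A] records the uncolored structure on [A] and the first [t] anchors. *)
Definition clab (V : finType) (w : {ffun 'I_M + V -> U}) :
    {ffun {set V} -> {ffun {set 'I_M} -> K}} :=
  [ffun A : {set V} => [ffun Q : {set 'I_M} =>
     if Q \subset anchors M (th #|A|) then c (w @: site Q A) else k0]].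

Definition elab (X : finType) (H : {set X} -> bool) (V : finType) (w : {ffun 'I_M + V -> X}) :
    {ffun {set V} -> {ffun {set 'I_M} -> bool}} :=
  [ffun A : {set V} => [ffun Q : {set 'I_M} =>
     (Q \subset anchors M t) && H (w @: site Q A)]].

Lemma clabE (V : finType) (w : {ffun 'I_M + V -> U}) (A : {set V}) Q :
  clab w A Q = if Q \subset anchors M (th #|A|) then c (w @: site Q A) else k0.
Proof. by rewrite [clab w A]ffunE ffunE. Qed.

Lemma elabE (X : finType) (H : {set X} -> bool) (V : finType)
    (w : {ffun 'I_M + V -> X}) (A : {set V}) Q :
  elab H w A Q = (Q \subset anchors M t) && H (w @: site Q A).
Proof. by rewrite [elab H w A]ffunE ffunE. Qed.

Section KernelDef.
Variable V : finType.
Implicit Types (A B : {set V}) (w : {ffun 'I_M + V -> U})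
  (zeta : {ffun {set V} -> {ffun {set 'I_M} -> K}})
  (gam : {ffun {set V} -> {ffun {set 'I_M} -> bool}}).

Definition consistent gam A zeta w : bool :=
  [forall B : {set V}, (B \subset A) ==>
     ((elab F w B == gam B) && ((B \proper A) ==> (clab w B == zeta B)))].

(* The conditional law in the sample of the label of [A], with an arbitrary value when
   nothing in the sample looks like [gam] and [zeta] below [A]. *)
Definition kernel gam A zeta (z : {ffun {set 'I_M} -> K}) : R :=
  let D := \sum_w (consistent gam A zeta w)%:R in
  if D == 0 then (z == [ffun => k0])%:R
  else (\sum_w (consistent gam A zeta w && (clab w A == z))%:R) / D.

Lemma kernel_ge0 gam A zeta z : 0 <= kernel gam A zeta z.
Proof.
rewrite /kernel; case: ifP => _; first exact: ler0n.
by rewrite divr_ge0 ?sumr_ge0.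
Qed.

Lemma kernel_sum1 gam A zeta : \sum_z kernel gam A zeta z = 1.
Proof.
rewrite /kernel /=; set D := \sum_w (consistent gam A zeta w)%:R.
have [_|D0] := eqVneq D 0.
  by rewrite (bigD1 [ffun => k0])//= eqxx big1 ?addr0// => z /negbTE ->.
rewrite -mulr_suml exchange_big /= (eq_bigr (fun w => (consistent gam A zeta w)%:R)).
  by rewrite -/D divff.
move=> w _; case: (consistent _ _ _ _) => /=; last by rewrite big1.
rewrite (bigD1 (clab w A))//= eqxx big1 ?addr0// => z.
by rewrite eq_sym => /negbTE ->.
Qed.

Lemma kernel_local gam A zeta zeta' z :
  (forall B, B \proper A -> zeta B = zeta' B) -> kernel gam A zeta z = kernel gam A zeta' z.
Proof.
move=> e; have ce w : consistent gam A zeta w = consistent gam A zeta' w.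
  apply: eq_forallb => B; congr (_ ==> (_ && _)).
  by case: (boolP (B \proper A)) => //= /e ->.
have DE : \sum_w (consistent gam A zeta w)%:R = \sum_w (consistent gam A zeta' w)%:R :> R.
  by apply: eq_bigr => w _; rewrite ce.
rewrite /kernel /= DE; case: ifP => // _; congr (_ / _).
by apply: eq_bigr => w _; rewrite ce.
Qed.

(** The local information as a single random variable: [consistent] says that two sample points have
    the same value of it. *)
Definition present A w :=
  ([ffun B : {set V} => if B \subset A then elab F w B else [ffun => false]],
   [ffun B : {set V} => if B \proper A then clab w B else [ffun => k0]]).

Lemma consistent_present A v w :
  consistent (elab F w) A (clab w) v = (present A v == present A w).
Proof.
apply/forallP/eqP => [e|[/ffunP e1 /ffunP e2] B].
  congr pair; apply/ffunP => B; rewrite [LHS]ffunE [RHS]ffunE.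
    by case: ifP => // BA; move: (e B); rewrite BA => /andP[/eqP].
  by case: ifP => // BA; move: (e B); rewrite BA (proper_sub BA) => /andP[_ /eqP].
apply/implyP => BA; move: (e1 B) (e2 B).
rewrite [LHS]ffunE [RHS]ffunE BA => -> e; rewrite eqxx /=.
by apply/implyP => pBA; move: e; rewrite [LHS]ffunE [RHS]ffunE pBA => ->.
Qed.

(** At data read off from [w] the conditioning event contains [w], so the default branch of [kernel]
    does not occur. *)
Lemma kernel_condexp A w z :
  kernel (elab F w) A (clab w) z = condexp (present A) (fun v => (clab v A == z)%:R) w.
Proof.
have DE : \sum_v (consistent (elab F w) A (clab w) v)%:R =
    #|[pred v | present A v == present A w]|%:R :> R.
  rewrite -sum1_card natr_sum [RHS]big_mkcond /=; apply: eq_bigr => v _.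
  by rewrite consistent_present inE; case: (_ == _).
rewrite /kernel DE gt_eqF ?condexp_card_gt0// /condexp; congr (_ / _).
rewrite [RHS]big_mkcond /=; apply: eq_bigr => v _.
by rewrite consistent_present; case: (present A v == _).
Qed.

End KernelDef.

Lemma clab_ext (V V' : finType) (y : V -> V') (w : {ffun 'I_M + V' -> U}) (B : {set V}) :
  injective y -> clab [ffun s => w (ext y s)] B = clab w (y @: B).
Proof.
move=> y_inj; apply/ffunP => Q; rewrite !clabE card_imset//; case: ifP => // _.
rewrite -ext_site -imset_comp; congr (c _).
by apply: eq_imset => s; rewrite ffunE.
Qed.

Lemma elab_ext (X : finType) (H : {set X} -> bool) (V V' : finType) (y : V -> V')
    (w : {ffun 'I_M + V' -> X}) (B : {set V}) :
  elab H [ffun s => w (ext y s)] B = elab H w (y @: B).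
Proof.
apply/ffunP => Q; rewrite !elabE -ext_site -imset_comp; congr (_ && H _).
by apply: eq_imset => s; rewrite ffunE.
Qed.

(** The conditions involve only the anchors and the vertices of [y @: A]; the free coordinates
    multiply numerator and denominator by the same nonzero power of [#|U|]. *)
Lemma kernel_restr (V V' : finType) (y : V -> V') gam (A : {set V}) zeta z :
    injective y -> (0 < #|U|)%N ->
  kernel gam (y @: A) zeta z = kernel (restr y gam) A (restr y zeta) z.
Proof.
move=> y_inj U0.
have ce w : consistent gam (y @: A) zeta w =
    consistent (restr y gam) A (restr y zeta) [ffun s => w (ext y s)].
  have ys (B1 B2 : {set V}) : (y @: B1 \subset y @: B2) = (B1 \subset B2).
    apply/idP/idP; last exact: imsetS.
    move=> /subsetP s; apply/subsetP => x xA; have := s (y x).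
    by rewrite !mem_imset// => ->.
  apply/forallP/forallP => e B.
    have := e (y @: B); rewrite !properE !ys clab_ext// elab_ext.
    by rewrite [restr _ _ _]ffunE [restr _ zeta _]ffunE.
  apply/implyP => BA; have yB : y @: (y @^-1: B) = B.
    by apply: imset_preimK; apply: subset_trans BA (imsetS _ (subsetT _)).
  have := e (y @^-1: B); rewrite clab_ext// elab_ext.
  rewrite [restr _ _ _]ffunE [restr _ zeta _]ffunE !properE -!ys yB BA.
  by move/implyP; apply.
have sE (phi : {ffun 'I_M + V -> U} -> bool) :
    \sum_(w : {ffun 'I_M + V' -> U}) (phi [ffun s => w (ext y s)])%:R =
    (#|U| ^ (#|{: 'I_M + V'}| - #|{: 'I_M + V}|))%:R * \sum_w (phi w)%:R :> R.
  exact: (sum_ffun_comp (fun w => (phi w)%:R) (ext_inj y_inj)).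
set C := (#|U| ^ _)%:R in sE.
have DE : \sum_w (consistent gam (y @: A) zeta w)%:R =
    C * \sum_w (consistent (restr y gam) A (restr y zeta) w)%:R.
  by rewrite -sE; apply: eq_bigr => w _; rewrite ce.
have NE : \sum_w (consistent gam (y @: A) zeta w && (clab w (y @: A) == z))%:R =
    C * \sum_w (consistent (restr y gam) A (restr y zeta) w && (clab w A == z))%:R.
  by rewrite -sE; apply: eq_bigr => w _; rewrite ce clab_ext.
rewrite /kernel /= DE NE.
have C0 : C != 0.
  by rewrite pnatr_eq0 -lt0n expn_gt0 U0.
rewrite mulf_eq0 (negbTE C0) /=; case: ifP => // /negbT D0.
by rewrite invfM mulrACA divff// mul1r.
Qed.

(** * The L1 error of the kernel *)

Section KernelError.
Variable V : finType.
Implicit Types (A B : {set V}) (v w : {ffun 'I_M + V -> U}).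

Lemma present_known A s v w : (s <= t)%N ->
    (forall B, B \proper A -> (s <= th #|B|)%N) -> present A v = present A w ->
  known k0 F c (site (anchors M s) set0) (site set0 A) v =
  known k0 F c (site (anchors M s) set0) (site set0 A) w.
Proof.
move=> st sth [/ffunP e1 /ffunP e2]; apply/ffunP => f; have [Q [B ->]] := siteP f.
rewrite [LHS]ffunE [RHS]ffunE siteU !subset_site sub0set set0U setU0 /=.
case: (boolP (Q \subset _)) => //= Qs; case: (boolP (B \subset A)) => //= BA.
congr pair.
  move: (e1 B); rewrite [LHS]ffunE [RHS]ffunE BA => /ffunP/(_ Q).
  by rewrite !elabE (subset_trans Qs (anchorsS _ st)).
case: ifPn => // AB; have pBA : B \proper A by rewrite properE BA.
move: (e2 B); rewrite [LHS]ffunE [RHS]ffunE pBA => /ffunP/(_ Q).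
by rewrite !clabE (subset_trans Qs (anchorsS _ (sth _ pBA))).
Qed.

(** The past involves no set containing [A], because such a set, if different from [A], has larger
    cardinality. Hence colors of sets not containing [A] suffice. *)
Lemma known_past A v w : (forall j, (th j <= t)%N) ->
    known k0 F c (site (anchors M t) (~: A)) (site set0 A) v =
    known k0 F c (site (anchors M t) (~: A)) (site set0 A) w ->
  past [ffun => k0] (elab F (V:=V)) (clab (V:=V)) A v =
  past [ffun => k0] (elab F (V:=V)) (clab (V:=V)) A w.
Proof.
move=> tht /ffunP e.
have {}e (Q : {set 'I_M}) (B : {set V}) : Q \subset anchors M t ->
    F (v @: site Q B) = F (w @: site Q B) /\
    (~~ (A \subset B) -> c (v @: site Q B) = c (w @: site Q B)).
  move=> Qt; move: (e (site Q B)); rewrite [LHS]ffunE [RHS]ffunE siteU !subset_site.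
  by rewrite sub0set setU0 Qt setUC setUCr subsetT /= => -[-> ]; case: ifP.
congr pair; apply/ffunP => B.
  apply/ffunP => Q; rewrite !elabE.
  by case: (boolP (Q \subset _)) => //= Qt; have [-> _] := e Q B Qt.
rewrite [LHS]ffunE [RHS]ffunE; case: ifP => // /andP[BA cBA].
apply/ffunP => Q; rewrite !clabE.
case: ifP => // Qth; have [_ -> //] := e Q B (subset_trans Qth (anchorsS _ (tht _))).
by apply: contra BA => AB; rewrite eq_sym eqEcard AB.
Qed.

Lemma clab_target A v w : (clab v A == clab w A) =
  (target k0 c (site (anchors M (th #|A|)) set0) (site set0 A) v ==
   target k0 c (site (anchors M (th #|A|)) set0) (site set0 A) w).
Proof.
apply/eqP/eqP => /ffunP e; apply/ffunP.
  move=> f; have [Q [B ->]] := siteP f.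
  rewrite [LHS]ffunE [RHS]ffunE siteU !subset_site sub0set set0U setU0 /=.
  case: ifP => // /and3P[AB Qth BA]; have BeA : B = A by apply/eqP; rewrite eqEsubset BA.
  by move: (e Q); rewrite !clabE Qth BeA.
move=> Q; rewrite !clabE.
case: ifP => // Qth; move: (e (site Q A)).
by rewrite [LHS]ffunE [RHS]ffunE siteU !subset_site sub0set set0U setU0 Qth subxx.
Qed.

Lemma clab_range A w : clab w A \in
  pffun_on k0 [pred Q : {set 'I_M} | Q \in powerset (anchors M (th #|A|))] K.
Proof.
apply/pffun_onP; split => [|x _ //]; apply/subsetP => Q.
by rewrite !inE clabE; case: ifP => //; rewrite eqxx.
Qed.

(** The energies of [past] and [present] lie between those for [s] anchors and for [t] anchors
    together with the vertices outside [A], so [condexp_l1] applies. The labels of [A] are supported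
    on subsets of the first [th #|A|] anchors, which bounds their number. *)
Lemma kernel_err A s (eta : R) : 0 < eta -> (s <= t)%N ->
    (forall B, B \proper A -> (s <= th #|B|)%N) -> (forall j, (th j <= t)%N) ->
    energy_of R k0 F c (site set0 A) (site (anchors M (th #|A|)) set0)
        (site (anchors M t) (~: A)) -
      energy_of R k0 F c (site set0 A) (site (anchors M (th #|A|)) set0)
        (site (anchors M s) set0) <= eta ^+ 2 ->
  avg (fun w : {ffun 'I_M + V -> U} =>
    \sum_z `|condexp (past [ffun => k0] (elab F (V:=V)) (clab (V:=V)) A)
               (fun v => (clab v A == z)%:R) w -
             kernel (elab F w) A (clab w) z|) <=
  eta * (#|K| ^ (2 ^ th #|A|))%:R.
Proof.
move=> eta0 st sth tht en.
under eq_avg do under eq_bigr do rewrite kernel_condexp.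
have K0 : (0 < #|K|)%N by apply/card_gt0P; exists k0.
apply: le_trans (condexp_l1 (Ym := present A) (Z := fun w => clab w A)
  (D := pffun_on k0 [pred Q : {set 'I_M} | Q \in powerset (anchors M (th #|A|))] K)
  _ _ eta0 _) _.
- move=> v w [ge /ffunP ce]; congr pair; apply/ffunP => B; rewrite [LHS]ffunE [RHS]ffunE.
    by rewrite ge.
  case: ifP => // BA; move: (ce B); rewrite [LHS]ffunE [RHS]ffunE proper_neq//.
  by rewrite subset_leq_card// proper_sub.
- exact: clab_range.
- apply: le_trans en; apply: lerB.
    rewrite (energy_eq _ (fun _ _ => erefl) (clab_target A)).
    apply: energy_le => v w; exact: known_past.
  rewrite [leRHS](energy_eq _ (fun _ _ => erefl) (clab_target A)).
  apply: energy_le => v w; exact: present_known.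
rewrite ler_wpM2l ?(ltW eta0)// ler_nat card_pffun_on.
rewrite (_ : #|[pred Q in _]| = 2 ^ #|anchors M (th #|A|)|)%N; last first.
  by rewrite -card_powerset; apply: eq_card.
by rewrite leq_pexp2l// leq_pexp2l// card_anchors geq_minl.
Qed.

End KernelError.

End Kernel.

(** * Lifting colorings *)

Definition pull (V I : finType) (C : Type) (H : {set V} -> C) (w : {ffun I -> V}) :
  {ffun {set I} -> C} := [ffun f : {set I} => H (w @: f)].

Definition join (I1 I2 V : finType) (x : {ffun I1 -> V}) (y : {ffun I2 -> V}) :
  {ffun I1 + I2 -> V} := [ffun s => match s with inl i => x i | inr j => y j end].

Section AvgMore.
Variable R : realFieldType.

Lemma avg_join (I1 I2 V : finType) (phi : {ffun I1 + I2 -> V} -> R) :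
  avg phi = avg (fun x => avg (fun y => phi (join x y))).
Proof.
rewrite /avg -mulr_suml -mulrA -invfM -natrM; congr (_ / _%:R); last first.
  by rewrite !card_ffun card_sum expnD mulnC.
rewrite pair_big /= (reindex (fun p => join p.1 p.2)) //=.
exists (fun w => ([ffun i => w (inl i)], [ffun j => w (inr j)])) => [[x y] _|w _] /=.
  by congr pair; apply/ffunP => i; rewrite !ffunE.
by apply/ffunP => -[i|i]; rewrite !ffunE.
Qed.

Lemma avg_law (T1 T2 S : finType) (X1 : T1 -> S) (X2 : T2 -> S) (psi : S -> R) :
    (forall s, 0 <= psi s <= 1) ->
  `|avg (fun w => psi (X1 w)) - avg (fun w => psi (X2 w))| <=
  \sum_s `|avg (fun w => (X1 w == s)%:R) - avg (fun w => (X2 w == s)%:R)|.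
Proof.
move=> psi01.
have E (T : finType) (X : T -> S) :
    avg (fun w => psi (X w)) = \sum_s psi s * avg (fun w => (X w == s)%:R).
  under [RHS]eq_bigr do rewrite -avgZ.
  rewrite -avg_sum; apply: eq_avg => w.
  rewrite (bigD1 (X w))//= eqxx mulr1 big1 ?addr0// => s.
  by rewrite eq_sym => /negbTE ->; rewrite mulr0.
rewrite !E -sumrB; apply: le_trans (ler_norm_sum _ _ _) _.
apply: ler_sum => s _; rewrite -mulrBr normrM.
by case/andP: (psi01 s) => p0 p1; rewrite (ger0_norm p0) ler_piMl.
Qed.

(** The indicator of non-injectivity has average 0 over injective maps. *)
Lemma avg_noninj (J V : finType) : (0 < #|V|)%N ->
  avg (fun w : {ffun J -> V} => (~~ injectiveb w)%:R) <= #|J|%:R ^+ 2 / #|V|%:R :> R.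
Proof.
move=> V0; have /(@avg_avg_inj R J V _ V0) :
    forall w : {ffun J -> V}, 0 <= ((~~ injectiveb w)%:R : R) <= 1.
  by move=> w; case: injectiveb; rewrite /= ?ler01 ?lexx.
apply: le_trans; rewrite [X in _ - X](_ : _ = 0) ?subr0 ?ler_norm//.
by rewrite /avg_inj big1 ?mul0r// => w ->.
Qed.

End AvgMore.

Definition by_card (V : finType) : seq {set V} :=
  sort (fun A B : {set V} => #|A| <= #|B|)%N (enum {set V}).

Lemma mem_by_card (V : finType) (A : {set V}) : A \in by_card V.
Proof. by rewrite mem_sort mem_enum. Qed.

Lemma by_card_uniq (V : finType) : uniq (by_card V).
Proof. by rewrite sort_uniq enum_uniq. Qed.

Lemma by_card_pairwise (V : finType) :
  pairwise (fun A B : {set V} => #|A| <= #|B|)%N (by_card V).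
Proof.
rewrite -sorted_pairwise; last by move=> A B C; exact: leq_trans.
by apply: sort_sorted => A B; exact: leq_total.
Qed.

Lemma by_card_topo (V : finType) : topo (by_card V).
Proof. exact: topo_card (by_card_uniq V) (by_card_pairwise V). Qed.

Section Lift.
Variables (R : archiRealFieldType) (K : finType) (k0 : K) (m : nat).

(* The thresholds are [th j = us (m - j)] and [t = us m.+1] for the scales [us]: larger sets
   are labelled using fewer anchors, so that the thresholds for smaller sets can be chosen
   after those for larger ones. *)
Lemma good_thresholds (eta : R) : 0 < eta -> exists M : nat,
  forall (U : finType) (F : {set U} -> bool) (c : {set U} -> K),
  exists (th : nat -> nat) (t : nat), forall A : {set 'I_m},
    avg (fun w : {ffun 'I_M + 'I_m -> U} =>
      \sum_z `|condexp (past [ffun => k0] (elab t F (V:='I_m)) (clab k0 th c (V:='I_m)) A)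
                 (fun v => (clab k0 th c v A == z)%:R) w -
               kernel R k0 th t F c (elab t F w) A (clab k0 th c w) z|) <=
    eta / (2 ^ m)%:R.
Proof.
move=> eta0.
have K0 : (0 < #|K|)%N by apply/card_gt0P; exists k0.
have P0 k : 0 < (#|K| ^ k)%:R :> R by rewrite ltr0n expn_gt0 K0.
have T0 : 0 < (2 ^ m)%:R :> R by rewrite ltr0n expn_gt0.
(* The factor [#|K| ^ (2 ^ u)] cancels the number of labels in [kernel_err]. *)
pose tol u : R := eta / (2 ^ m)%:R / (#|K| ^ (2 ^ u))%:R.
have tol0 u : 0 < tol u by rewrite !divr_gt0.
pose L u := (Num.truncn (tol u ^+ 2)^-1).+1.
have LP u : 1 < (L u)%:R * tol u ^+ 2.
  by rewrite -ltr_pdivrMr ?exprn_gt0// div1r truncnS_gt.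
(* There are [m.+1] increments, one for each cardinality from [m] down to 0; the margin [m] leaves
   spare anchors to stand in for vertices. *)
pose M := scale_bound L m m.+1 0.
exists M => U F c.
(* By exchangeability one representative set of each cardinality suffices. *)
pose A0 i : {set 'I_m} := anchors m (m - i).
pose e i u s := energy_of R k0 F c (site set0 (A0 i)) (site (anchors M u) set0)
  (site (anchors M s) set0).
have e_le i u s s' : (s <= s')%N -> e i u s <= e i u s'.
  by move=> ss'; apply: energy_of_le; rewrite subset_site anchorsS// subxx.
have [us [us0 us_le us_top us_e]] := scales m LP m.+1 0 e_le (fun i u s => energy01 R _ _).
have us_mono i j : (i <= j <= m.+1)%N -> (us i <= us j)%N.
  move=> /andP[ij jm]; move: ij jm => /subnKC <-.
  elim: (j - i)%N => [|d IH]; first by rewrite addn0.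
  by rewrite addnS => dm; apply: leq_trans (IH (ltnW dm)) (us_le _ dm).
pose th j := us (m - j)%N; pose t := us m.+1.
have tM : (t + m <= M)%N by [].
have tht j : (th j <= t)%N by apply: us_mono; rewrite leqnn andbT; lia.
have usM i : (i <= m.+1)%N -> (us i <= M)%N.
  move=> im; apply: leq_trans (us_mono i m.+1 _) (leq_trans (leq_addr m _) tM).
  by rewrite im leqnn.
exists th, t => A.
have Am : (#|A| <= m)%N by have := max_card A; rewrite card_ord.
pose i := (m - #|A|)%N; have im : (i <= m)%N by rewrite leq_subr.
have iA : (m - i = #|A|)%N by rewrite subKn.
have -> : eta / (2 ^ m)%:R = tol (th #|A|) * (#|K| ^ (2 ^ th #|A|))%:R.
  by rewrite /tol mulfVK// gt_eqF.
apply: (@kernel_err _ _ _ _ _ _ _ _ _ _ _ (us i.+1)) => //.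
- by apply: us_mono; rewrite leqnn andbT ltnS.
- move=> B /proper_card BA; apply: us_mono; rewrite /i ltn_sub2l ?(leq_trans BA)//=.
  by rewrite (leq_trans (leq_subr _ _)).
have disjA (s : nat) : [disjoint site set0 A & site (anchors M s) set0].
  by apply: disjoint_site; rewrite -setI_eq0 ?set0I ?setI0.
have cardA0 : #|A0 i| = #|A| by rewrite card_anchors iA; apply/minn_idPl.
have disjA0 (s : nat) : [disjoint site set0 (A0 i) & site (anchors M s) set0].
  by apply: disjoint_site; rewrite -setI_eq0 ?set0I ?setI0.
have ssub (s s' : nat) (B : {set 'I_m}) : (s <= s')%N ->
    site (anchors M s) set0 \subset site (anchors M s') B.
  by move=> ss'; rewrite subset_site anchorsS// sub0set.
apply: le_trans (us_e i _); last by rewrite ltnS.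
rewrite -/(th _) -/t; apply: lerB.
  (* The vertices outside [A] are traded for equally many anchors beyond the first [t], available
     because [t + m <= M]. *)
  apply: (@le_trans _ _ (e i (us i) (t + #|~: A|)%N)).
    rewrite le_eqVlt; apply/orP; left; apply/eqP; apply: energy_of_card => //.
    - exact/ssub/tht.
    - by apply: disjoint_site; rewrite -setI_eq0 ?set0I ?setICr.
    - by apply: ssub; rewrite (leq_trans (us_mono i m.+1 _)) ?leq_addr//; lia.
    - by rewrite !card_site cardA0.
    - rewrite !card_site cards0 !addn0 !card_anchors.
      have := max_card (~: A); rewrite card_ord => Acm.
      by rewrite (minn_idPl _) ?(minn_idPl _)//; lia.
  by apply: e_le; rewrite leq_add2l; have := max_card (~: A); rewrite card_ord.
rewrite le_eqVlt; apply/orP; left; apply/eqP; apply: energy_of_card => //.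
- exact/ssub/us_le.
- by apply: ssub; exact/us_le.
- by rewrite !card_site cardA0.
Qed.

(** The average over [F] is compared with that of [Psi], the mean result of redrawing all colors by
    the kernel of the sample: first on [F], at cost [eta / 2] by the hybrid argument, then on [G],
    at cost [eta / 2] by closeness of the uncolored laws. Finally the anchors in [G] and the outcome
    of the draws are fixed; non-injective [y] account for the last error term. *)
Lemma lift_coloring (eta : R) : 0 < eta -> exists M : nat, exists2 delta : R, 0 < delta &
  forall (U V : finType) (F : {set U} -> bool) (c : {set U} -> K) (G : {set V} -> bool)
    (h : {ffun {set 'I_m} -> bool * K} -> R),
    (forall x, 0 <= h x <= 1) -> (0 < #|U|)%N -> (0 < #|V|)%N ->
    \sum_(gam : {ffun {set 'I_M + 'I_m} -> bool})
      `|avg (fun w => (pull F w == gam)%:R) - avg (fun w => (pull G w == gam)%:R)| <= delta ->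
  exists c' : {set V} -> K,
    avg (fun y => h (pull (fun f => (F f, c f)) y)) - eta - m%:R ^+ 2 / #|V|%:R <=
    avg (fun y => h (pull (fun f => (G f, c' f)) y)).
Proof.
move=> eta0; have eta2 : 0 < eta / 2 by rewrite divr_gt0.
have [M good] := good_thresholds eta2.
exists M, (eta / 2) => // U V F c G h h01 U0 V0 law.
have [th [t err]] := good U F c.
pose ker (X : finType) := kernel R (M := M) (V := X) k0 th t F c.
(* The entries at the empty anchor set are the structure and the colors on ['I_m] itself. *)
pose hW (gam : {ffun {set 'I_m} -> {ffun {set 'I_M} -> bool}})
    (zeta : {ffun {set 'I_m} -> {ffun {set 'I_M} -> K}}) : R :=
  h [ffun B => (gam B set0, zeta B set0)].
have hW01 gam zeta : 0 <= hW gam zeta <= 1 by exact: h01.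
pose zeta0 (X : finType) : {ffun {set X} -> {ffun {set 'I_M} -> K}} := [ffun => [ffun => k0]].
pose Psi gam := seqsample (ker _ gam) (by_card 'I_m) (zeta0 _) (hW gam).
have ker_ge0 X gam A zeta z : 0 <= ker X gam A zeta z by exact: kernel_ge0.
have ker_sum1 X gam A zeta : \sum_z ker X gam A zeta z = 1 by exact: kernel_sum1.
have Psi01 gam : 0 <= Psi gam <= 1 by exact: seqsample01.
have full (X : finType) gam l zeta : topo l -> (forall A, A \in l) ->
    seqsample (ker _ gam) l zeta (hW gam) = Psi gam.
  move=> tl al; apply: seqsample_full => //; [|exact: by_card_topo|exact: mem_by_card].
  by move=> A z1 z2 z; exact: kernel_local.
have colored_U : avg (fun w => hW (elab t F w) (clab k0 th c w)) =
    avg (fun y => h (pull (fun f => (F f, c f)) y)).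
  rewrite -(avg_ffun_comp (p := inr : 'I_m -> 'I_M + 'I_m) _ _ U0); last by move=> ? ? [].
  apply: eq_avg => w; congr h; apply/ffunP => B; rewrite [LHS]ffunE [RHS]ffunE.
  rewrite elabE clabE !sub0set /=.
  by rewrite /site imset0 set0U -imset_comp; congr (F _, c _); apply: eq_imset => i; rewrite ffunE.
have step1 : `|avg (fun w => Psi (elab t F w)) -
    avg (fun y => h (pull (fun f => (F f, c f)) y))| <= eta / 2.
  rewrite -colored_U.
  have -> : avg (fun w => Psi (elab t F w)) = avg (fun w : {ffun 'I_M + 'I_m -> U} =>
      seqsample (ker _ (elab t F w)) (by_card 'I_m) (clab k0 th c w) (hW (elab t F w))).
    apply: eq_avg => w; rewrite full//; first exact: by_card_topo.
    exact: mem_by_card.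
  apply: le_trans (hybrid (k0 := [ffun => k0]) (g := elab t F (V:='I_m))
    (Z := clab k0 th c (V:='I_m)) (kap := ker 'I_m) (h := hW)
    (err := fun=> eta / 2 / (2 ^ m)%:R) _ _ _ hW01 err (by_card_uniq _)
    (by_card_pairwise _) _) _ => //.
  - by move=> gam A z1 z2 z; exact: kernel_local.
  - by move=> A B _; rewrite mem_by_card.
  rewrite big_const_seq count_predT size_sort -cardE -cardsT -powersetT card_powerset.
  by rewrite cardsT card_ord iter_addr_0 -[_ *+ _]mulr_natr mulfVK// pnatr_eq0 -lt0n expn_gt0.
have step2 : `|avg (fun w => Psi (elab t F w)) - avg (fun w => Psi (elab t G w))| <= eta / 2.
  pose theta (gam : {ffun {set 'I_M + 'I_m} -> bool}) :
      {ffun {set 'I_m} -> {ffun {set 'I_M} -> bool}} :=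
    [ffun A : {set 'I_m} => [ffun Q : {set 'I_M} => (Q \subset anchors M t) && gam (site Q A)]].
  have thetaE (X : finType) (H : {set X} -> bool) (w : {ffun 'I_M + 'I_m -> X}) :
      elab t H w = theta (pull H w).
    by apply/ffunP => A; apply/ffunP => Q; rewrite elabE [theta _ _]ffunE !ffunE.
  under eq_avg do rewrite thetaE; under [X in _ - X]eq_avg do rewrite thetaE.
  apply: le_trans law; apply: (avg_law (pull F) (pull G) (psi := Psi \o theta)) => gam.
  exact: Psi01.
have [x step3] : exists x, avg (fun w => Psi (elab t G w)) <=
    avg (fun y => Psi (elab t G (join x y))).
  rewrite avg_join; apply: avg_le_ex.
  by rewrite card_ffun expn_gt0 V0.
(* With the anchors fixed at [x], the uncolored data of all of [V], of which every [y] sees a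
   restriction. *)
pose gx := elab (M := M) t G (join x [ffun v : V => v]).
have gxE (y : {ffun 'I_m -> V}) : elab t G (join x y) = restr y gx.
  apply/ffunP => B; rewrite [RHS]ffunE -elab_ext; congr (elab t G _ B).
  by apply/ffunP => -[i|i]; rewrite !ffunE /= ?ffunE.
pose Hy (y : {ffun 'I_m -> V}) zeta := hW (restr y gx) (restr y zeta).
(* For injective [y], drawing on [V] and restricting is drawing on ['I_m], so a single drawing on
   [V] serves all such [y] at once. *)
have inj_step (y : {ffun 'I_m -> V}) : injectiveb y ->
    Psi (elab t G (join x y)) = seqsample (ker V gx) (by_card V) (zeta0 V) (Hy y).
  move=> /injectiveP y_inj; rewrite gxE /Hy.
  rewrite (seqsample_restr y_inj (kap := ker _ (restr y gx))); first last.
  - exact: ker_sum1.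
  - by move=> A zeta z; exact: kernel_restr.
  rewrite full// => [|A]; first exact/topo_restr/by_card_topo.
  exact/mem_restr_seq/mem_by_card.
have [zeta zetaP] := seqsample_le_ex (ker_ge0 V gx) (ker_sum1 V gx) (by_card V) (zeta0 V)
  (fun z => avg (fun y => Hy y z)).
exists (fun f => zeta f set0).
have -> : avg (fun y : {ffun 'I_m -> V} => h (pull (fun f => (G f, zeta f set0)) y)) =
    avg (fun y => Hy y zeta).
  apply: eq_avg => y; congr h; apply/ffunP => B; rewrite [LHS]ffunE [RHS]ffunE.
  rewrite [restr _ gx B]ffunE [restr _ zeta B]ffunE elabE sub0set /=; congr (G _, _).
  rewrite /site imset0 set0U -!imset_comp.
  by apply: eq_imset => v /=; rewrite !ffunE.
apply: le_trans zetaP; rewrite seqsample_avg.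
have noninj := @avg_noninj R 'I_m V V0; rewrite card_ord in noninj.
suff : avg (fun y => Psi (elab t G (join x y))) <=
    avg (fun y => seqsample (ker V gx) (by_card V) (zeta0 V) (Hy y)) + m%:R ^+ 2 / #|V|%:R.
  move: step1 step2; rewrite !ler_norml => /andP[s1 _] /andP[_ s2]; lra.
apply: le_trans (lerD (lexx _) noninj); rewrite -avgD; apply: ler_avg => y.
have [/inj_step ->|_] := boolP (injectiveb y); first by rewrite addr0.
have /andP[_ p1] := Psi01 (elab t G (join x y)).
apply: le_trans p1 _; rewrite lerDr.
by case/andP: (seqsample01 (ker_ge0 V gx) (ker_sum1 V gx) (by_card V) (zeta0 V)
  (fun z => hW01 (restr y gx) (restr y z))).
Qed.
End Lift.

(** * Concentration of sampling statistics *)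

Section Concentration.
Variables (R : realFieldType) (n q : nat).

Lemma sum_redge (f : {set 'I_n} -> R) :
  \sum_(S : redge q n) f (val S) = \sum_(S : {set 'I_n} | #|S| == q) f S.
Proof. exact/esym/(big_sub [pred S : {set 'I_n} | #|S| == q]). Qed.

Lemma card_redge : #|{: redge q n}| = 'C(n, q).
Proof.
rewrite card_sig -[in RHS](card_ord n) -[in RHS]cardsT -cards_draws.
by apply: eq_card => S; rewrite !inE subsetT.
Qed.

Lemma card_supersets (B : {set 'I_n}) : (#|B| <= q)%N ->
  #|[set S : {set 'I_n} | (#|S| == q) && (B \subset S)]| = 'C(n - #|B|, q - #|B|).
Proof.
move=> Bq; have <- : #|~: B| = (n - #|B|)%N by rewrite cardsCs setCK card_ord.
rewrite -cards_draws -(card_in_imset (f := fun S => S :\: B)); last first.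
  move=> S1 S2; rewrite !inE => /andP[_ /setIidPr e1] /andP[_ /setIidPr e2] e.
  by rewrite -(setID S1 B) -(setID S2 B) e1 e2 e.
apply: eq_card => A; rewrite !inE; apply/imsetP/andP => [[S]|[AB /eqP cA]].
  rewrite inE => /andP[/eqP Sq BS] ->; split; first by rewrite setDE subsetIr.
  by rewrite cardsD (setIidPr BS) Sq.
have dAB : A :&: B = set0 by apply/eqP; rewrite setI_eq0 disjoints_subset.
exists (A :|: B); last first.
  by rewrite setDUl setDv setU0; apply/esym/setDidPl; rewrite -setI_eq0 dAB.
by rewrite inE subsetUr andbT cardsU dAB cards0 subn0 cA subnK.
Qed.

Definition subsample (J : finType) (b : {ffun J -> 'I_n} -> R) (S : {set 'I_n})
    (s : {ffun J -> 'I_#|S|}) : R := b [ffun j => enum_val (s j)].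

Lemma sum_subsample (J : finType) (b : {ffun J -> 'I_n} -> R) (S : {set 'I_n}) :
  \sum_(s : {ffun J -> 'I_#|S|} | injectiveb s) subsample b s =
  \sum_(w : {ffun J -> 'I_n} | injectiveb w && ([set w j | j : J] \subset S)) b w.
Proof.
pose h (s : {ffun J -> 'I_#|S|}) : {ffun J -> 'I_n} := [ffun j => enum_val (s j)].
have h_inj : injective h.
  move=> s1 s2 /ffunP e; apply/ffunP => j; apply: enum_val_inj.
  by move: (e j); rewrite !ffunE.
transitivity (\sum_(s in [set s : {ffun J -> 'I_#|S|} | injectiveb s]) b (h s)).
  by apply: eq_bigl => s; rewrite inE.
rewrite -(big_imset (h := h) b) /=; last by move=> ? ? _ _; exact: h_inj.
apply: eq_bigl => w; apply/imsetP/andP => [[s] | [/injectiveP w_inj /subsetP wS]].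
  rewrite inE => /injectiveP s_inj ->; split.
    by apply/injectiveP => i j; rewrite !ffunE => /enum_val_inj/s_inj.
  by apply/subsetP => x /imsetP[j _ ->]; rewrite ffunE enum_valP.
have wS' j : w j \in S by apply: wS; rewrite imset_f.
have hE : w = h [ffun j => enum_rank_in (wS' j) (w j)].
  by apply/ffunP => j; rewrite !ffunE enum_rankK_in.
exists [ffun j => enum_rank_in (wS' j) (w j)] => //.
rewrite inE; apply/injectiveP => i j e; apply: w_inj.
by rewrite hE [LHS]ffunE [RHS]ffunE e.
Qed.

(** Double counting: the image of an injective [w] lies in exactly ['C(n - #|J|, q - #|J|)] of the
    sets [S]. *)
Lemma avg_inj_draws (J : finType) (b : {ffun J -> 'I_n} -> R) : (#|J| <= q <= n)%N ->
  avg (fun S : redge q n => avg_inj (subsample b (S := val S))) = avg_inj b.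
Proof.
move=> /andP[Jq qn].
have sum_b b' : \sum_(S : redge q n) \sum_(s : {ffun J -> 'I_#|val S|} | injectiveb s)
    subsample b' s =
    'C(n - #|J|, q - #|J|)%:R * \sum_(w : {ffun J -> 'I_n} | injectiveb w) b' w.
  rewrite (sum_redge (fun S => \sum_(s : {ffun J -> 'I_#|S|} | injectiveb s) subsample b' s)).
  under eq_bigr do rewrite sum_subsample big_mkcondr /=.
  rewrite exchange_big /= mulr_sumr; apply: eq_bigr => w /injectiveP w_inj.
  rewrite -big_mkcondr sumr_const mulr_natl; congr (_ *+ _).
  have cw : #|[set w j | j : J]| = #|J| by rewrite card_imset.
  rewrite -cw -card_supersets ?cw//; apply: eq_card => S; rewrite inE.
  by rewrite unfold_in.
have cinj (T : finType) (x : R) :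
    \sum_(s : {ffun J -> T} | injectiveb s) x = x *+ (#|T| ^_ #|J|).
  rewrite sumr_const -card_inj_ffuns; congr (_ *+ _).
  by apply: eq_card => w; rewrite !inE.
have cS (S : redge q n) : #|'I_#|val S| | = q by rewrite card_ord; exact/eqP/(valP S).
(* The case [b' = 1] of [sum_b] supplies the normalization. *)
have bin_eq : (q ^_ #|J| * 'C(n, q))%:R = ('C(n - #|J|, q - #|J|) * n ^_ #|J|)%:R :> R.
  rewrite [RHS]natrM; have := sum_b (fun=> 1); rewrite cinj card_ord => <-.
  rewrite (eq_bigr (fun=> (q ^_ #|J|)%:R)) => [|S _]; last first.
    by rewrite /subsample cinj cS.
  by rewrite sumr_const card_redge -mulrnA.
rewrite /avg card_redge.
rewrite (eq_bigr (fun S : redge q n => (q ^_ #|J|)%:R^-1 *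
   \sum_(s : {ffun J -> 'I_#|val S|} | injectiveb s) subsample b s)); last first.
  by move=> S _; rewrite /avg_inj cS mulrC.
rewrite -mulr_sumr sum_b /avg_inj card_ord.
have C0 : 'C(n, q)%:R != 0 :> R by rewrite pnatr_eq0 -lt0n bin_gt0.
have q0 : (q ^_ #|J|)%:R != 0 :> R by rewrite pnatr_eq0 -lt0n ffact_gt0.
have n0 : (n ^_ #|J|)%:R != 0 :> R.
  by rewrite pnatr_eq0 -lt0n ffact_gt0 (leq_trans Jq).
move: bin_eq; rewrite !natrM => e.
set s := \sum_(_ | _) _.
have -> : 'C(n - #|J|, q - #|J|)%:R = (q ^_ #|J|)%:R * 'C(n, q)%:R / (n ^_ #|J|)%:R :> R.
  by rewrite e mulfK.
by field; rewrite C0 q0 n0.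
Qed.

Lemma avg_avg_inj_subsample (J : finType) (b : {ffun J -> 'I_n} -> R) (S : redge q n) :
  (0 < q)%N -> (forall w, 0 <= b w <= 1) ->
  `|avg (subsample b (S := val S)) - avg_inj (subsample b (S := val S))| <=
  #|J|%:R ^+ 2 / q%:R.
Proof.
move=> q0 b01; have cS : #|'I_#|val S| | = q by rewrite card_ord; exact/eqP/(valP S).
rewrite -[q in X in _ <= X]cS; apply: avg_avg_inj; last by move=> w; exact: b01.
by rewrite cS.
Qed.

Hypothesis q_range : (1 <= q <= n)%N.

Let card_redge_gt0 : (0 < #|{: redge q n}|)%N.
Proof. by rewrite card_redge bin_gt0; case/andP: q_range. Qed.

Lemma first_moment (J : finType) (b : {ffun J -> 'I_n} -> R) :
  (forall w, 0 <= b w <= 1) ->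
  `|avg (fun S : redge q n => avg (subsample b (S := val S))) - avg b| <=
  2 * (#|J|%:R ^+ 2 / q%:R).
Proof.
move=> b01; have /andP[q0 qn] := q_range.
have n0 : (0 < n)%N by exact: leq_trans qn.
have q0R : 0 < q%:R :> R by rewrite ltr0n.
have [Jq|qJ] := leqP #|J| q; last first.
  have sub01 S : 0 <= avg (subsample b (S := S)) <= 1.
    by rewrite avg_ge0 ?avg_le1// => w; case/andP: (b01 [ffun j => enum_val (w j)]).
  have l01 : 0 <= avg (fun S : redge q n => avg (subsample b (S := val S))) <= 1.
    by rewrite avg_ge0 ?avg_le1// => S; case/andP: (sub01 (val S)).
  have r01 : 0 <= avg b <= 1 by rewrite avg_ge0 ?avg_le1// => w; case/andP: (b01 w).
  have : 1 <= #|J|%:R ^+ 2 / q%:R :> R.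
    rewrite ler_pdivlMr// mul1r -natrX ler_nat (leq_trans (ltnW qJ))//.
    by rewrite expnS leq_pmulr// expn1 (leq_trans q0)// ltnW.
  rewrite ler_norml; lra.
have S_le : `|avg (fun S : redge q n => avg (subsample b (S := val S))) - avg_inj b| <=
    #|J|%:R ^+ 2 / q%:R.
  rewrite -avg_inj_draws ?Jq// -avgB; apply: le_trans (ler_norm_avg _) _.
  rewrite -[leRHS](avg_cst _ card_redge_gt0); apply: ler_avg => S.
  exact: avg_avg_inj_subsample.
have V_le : `|avg b - avg_inj b| <= #|J|%:R ^+ 2 / q%:R.
  apply: le_trans (avg_avg_inj _ b01) _; rewrite card_ord//.
  by rewrite ler_wpM2l ?exprn_ge0 ?ler0n// lef_pV2 ?posrE ?ltr0n// ler_nat.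
move: S_le V_le; rewrite !ler_norml => /andP[s1 s2] /andP[v1 v2].
by apply/andP; split; lra.
Qed.

(** The two halves of a map on [J + J] are independent. *)
Lemma avg_prod (J V : finType) (b : {ffun J -> V} -> R) :
  avg (fun w : {ffun J + J -> V} =>
    b [ffun j => w (inl j)] * b [ffun j => w (inr j)]) = avg b ^+ 2.
Proof.
rewrite avg_join expr2 -avgZ; apply: eq_avg => x; rewrite mulrC -avgZ; apply: eq_avg => y.
by congr (b _ * b _); apply/ffunP => j; rewrite !ffunE.
Qed.

(** The first moment bound is applied to [b] and to [b2] on [J + J], whose subsample average is the
    square of that of [b]. With [x = #|J|^2 / q] the errors are [8 x] for the square and [4 x] for
    the cross term. *)
Lemma second_moment (J : finType) (b : {ffun J -> 'I_n} -> R) :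
  (forall w, 0 <= b w <= 1) ->
  avg (fun S : redge q n => (avg (subsample b (S := val S)) - avg b) ^+ 2) <=
  12 * (#|J|%:R ^+ 2 / q%:R).
Proof.
move=> b01; pose b2 (w : {ffun J + J -> 'I_n}) :=
  b [ffun j => w (inl j)] * b [ffun j => w (inr j)].
have b201 w : 0 <= b2 w <= 1.
  have /andP[u0 u1] := b01 [ffun j => w (inl j)].
  have /andP[v0 v1] := b01 [ffun j => w (inr j)].
  by rewrite mulr_ge0//= mulr_ile1.
have m1 := first_moment b01; have m2 := first_moment b201.
have b2S (S : redge q n) : avg (subsample b2 (S := val S)) =
    avg (subsample b (S := val S)) ^+ 2.
  rewrite -avg_prod; apply: eq_avg => w.
  by congr (b _ * b _); apply/ffunP => j; rewrite !ffunE.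
have ab01 : 0 <= avg b <= 1.
  by rewrite avg_ge0 ?avg_le1// => w; case/andP: (b01 w).
rewrite avg_prod card_sum (eq_avg b2S) natrD in m2.
rewrite (eq_avg (g := fun S : redge q n => avg (subsample b (S := val S)) ^+ 2 -
    (2 * avg b * avg (subsample b (S := val S)) - avg b ^+ 2))); last by move=> S; ring.
rewrite avgB avgB avgZ avg_cst//.
have E8 : 2 * ((#|J|%:R + #|J|%:R) ^+ 2 / q%:R) = 8 * (#|J|%:R ^+ 2 / q%:R) :> R by ring.
move: m1 m2 ab01; rewrite E8 !ler_norml.
set x := #|J|%:R ^+ 2 / q%:R; set a := avg b.
move: (avg _) (avg _) => A1 A2.
have x0 : 0 <= x by rewrite divr_ge0 ?exprn_ge0.
move=> /andP[m1 _] /andP[_ m2] /andP[a0 a1].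
nra.
Qed.

End Concentration.

(** * Sampling probabilities *)

Section TotalExtension.
Variables (r : nat) (C : finType) (c0 : C).

(* Pullbacks along non-injective maps evaluate [G] on sets of fewer than r vertices. *)
Definition tot n (G : cgraph r C n) (f : {set 'I_n}) : C :=
  if insub f is Some e then G e else c0.

Lemma tot_val n (G : cgraph r C n) (e : redge r n) : tot G (val e) = G e.
Proof. by rewrite /tot valK. Qed.

Lemma tot_pullback n' n (f : 'I_n' -> 'I_n) (f_inj : injective f) (G : cgraph r C n)
  (X : {set 'I_n'}) : tot (pullback f_inj G) X = tot G (f @: X).
Proof.
rewrite /tot; case: insubP => [e _ eX|nX].
  have <- : val (redge_imset f_inj e) = f @: X by rewrite /= eX.
  by rewrite valK ffunE.
by rewrite insubN// card_imset.
Qed.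

(** Such an injection is a relabeling; keeping [n'] apart from [n] covers [induced], which lives on
    [#|S|] vertices. *)
Lemma mem_pullback (P : property r C) n' n (s : 'I_n' -> 'I_n) (s_inj : injective s)
  (G : cgraph r C n) : n' = n -> (pullback s_inj G \in P n') = (G \in P n).
Proof.
move=> e; subst n'; rewrite -[RHS](property_relabel P (perm s_inj)).
suff -> : pullback s_inj G = relabel (perm s_inj) G by [].
apply/ffunP => f; rewrite !ffunE; congr (G _).
by apply/eqP; rewrite -val_eqE /=; apply/eqP/eq_imset => i; rewrite permE.
Qed.

End TotalExtension.

Definition edge_restr r (C : finType) m (a : {ffun {set 'I_m} -> C}) : cgraph r C m :=
  [ffun e => a (val e)].

Section SampleProb.
Variables (R : realType) (r : nat) (C : finType).

Lemma eq_avg_inj (J V : finType) (b b' : {ffun J -> V} -> R) :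
  (forall w : {ffun J -> V}, injective w -> b w = b' w) -> avg_inj b = avg_inj b'.
Proof. by move=> e; congr (_ / _); apply: eq_bigr => w /injectiveP; exact: e. Qed.

Lemma avg_inj_cst (J V : finType) (x : R) : (#|J| <= #|V|)%N ->
  avg_inj (fun _ : {ffun J -> V} => x) = x.
Proof.
move=> JV; rewrite /avg_inj sumr_const -[x *+ _]mulr_natr.
rewrite (_ : #|_| = #|V| ^_ #|J|) ?mulfK ?pnatr_eq0 -?lt0n ?ffact_gt0//.
by rewrite -card_inj_ffuns; apply: eq_card => w; rewrite !inE.
Qed.

Lemma sample_prob_avg n q (G : cgraph r C n) (P : property r C) :
  sample_prob R q G P = avg (fun S : redge q n => (induced G (val S) \in P #|val S|)%:R).
Proof.
rewrite /avg (sum_redge q (fun S : {set 'I_n} => (induced G S \in P #|S|)%:R)) card_redge.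
rewrite /sample_prob -sum1_card natr_sum; congr (_ / _%:R).
  rewrite (eq_bigl (fun S : {set 'I_n} => (#|S| == q) && (induced G S \in P #|S|))).
    by rewrite big_mkcondr; apply: eq_bigr => S _; case: (_ \in _).
  by move=> S; rewrite inE.
rewrite -card_redge card_sig; apply: eq_card => S; rewrite !inE//.
Qed.

(** A random injection numbers a random [m]-set of vertices at random, and by invariance of [P] the
    numbering is immaterial. *)
Lemma sample_prob_avg_inj n m (G : cgraph r C n) (P : property r C) (H : {set 'I_n} -> C) :
    (forall e, H (val e) = G e) -> (m <= n)%N ->
  sample_prob R m G P =
  avg_inj (fun w : {ffun 'I_m -> 'I_n} => (edge_restr r (pull H w) \in P m)%:R).
Proof.
move=> HG mn; rewrite -(avg_inj_draws (q := m)) ?card_ord ?leqnn// sample_prob_avg.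
apply: eq_avg => S; have Sm : #|val S| = m by exact/eqP/(valP S).
rewrite -[LHS](@avg_inj_cst 'I_m 'I_#|val S|); last by rewrite !card_ord Sm.
apply: eq_avg_inj => w w_inj; congr (_%:R); rewrite -(mem_pullback P w_inj)//.
rewrite (_ : edge_restr _ _ = pullback w_inj (induced G (val S)))//.
apply/ffunP => e; rewrite !ffunE -HG; congr (H _).
by rewrite /= -imset_comp; apply: eq_imset => i; rewrite /= ffunE.
Qed.

Lemma sample_prob_relabel n m (s : 'S_n) (G : cgraph r C n) (P : property r C) (c0 : C) :
  (m <= n)%N -> sample_prob R m (relabel s G) P = sample_prob R m G P.
Proof.
move=> mn; rewrite !(sample_prob_avg_inj _ (tot_val c0 _))//.
pose h (w : {ffun 'I_m -> 'I_n}) : {ffun 'I_m -> 'I_n} := [ffun i => s (w i)].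
have hb : bijective h.
  exists (fun w : {ffun 'I_m -> 'I_n} => [ffun i => (s^-1)%g (w i)]) => w;
    apply/ffunP => i; rewrite !ffunE ?permK ?permKV//.
rewrite /avg_inj [in RHS](reindex h) /=; last exact: onW_bij.
congr (_ / _); apply: eq_big => w.
  apply/injectiveP/injectiveP => w_inj i j.
    by rewrite !ffunE => /perm_inj/w_inj.
  by move=> e; apply: w_inj; rewrite !ffunE e.
move=> _; rewrite (_ : edge_restr r (pull (tot c0 (relabel s G)) w) =
  edge_restr r (pull (tot c0 G) (h w)))//; apply/ffunP => e; rewrite !ffunE.
rewrite tot_pullback -imset_comp; congr (tot _ _ _).
by apply: eq_imset => i; rewrite /= ffunE.
Qed.

End SampleProb.

Lemma pull_induced r (C : finType) (c0 : C) n (G : cgraph r C n) (S : {set 'I_n})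
    (I : finType) (s : {ffun I -> 'I_#|S|}) :
  pull (tot c0 (induced G S)) s = pull (tot c0 G) [ffun j => enum_val (s j)].
Proof.
apply/ffunP => f; rewrite !ffunE tot_pullback -imset_comp; congr (tot _ _ _).
by apply: eq_imset => i; rewrite /= ffunE.
Qed.

(** * Passing the witness test between a graph and its samples *)

Section Transfer.
Variables (R : realType) (r m : nat).

Lemma sample_prob_induced (C : finType) (c0 : C) n (G : cgraph r C n) (P : property r C)
    (S : {set 'I_n}) : (m <= #|S|)%N ->
  sample_prob R m (induced G S) P =
  avg_inj (subsample (fun w => (edge_restr r (pull (tot c0 G) w) \in P m)%:R) (S := S)).
Proof.
move=> mS; rewrite (sample_prob_avg_inj _ _ (tot_val c0 _))//.
by apply: eq_avg_inj => w _; rewrite /subsample pull_induced.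
Qed.

Lemma ratio_le (q c : nat) : (0 < q)%N -> (c * m ^ 2 <= q)%N ->
  c%:R * (m%:R ^+ 2 / q%:R) <= 1 :> R.
Proof.
move=> q0 cq; rewrite mulrA ler_pdivrMr ?ltr0n// mul1r.
by rewrite -natrX -natrM ler_nat.
Qed.

Lemma sample_complete (C : finType) (c0 : C) (P : property r C) :
  exists q0 : nat, forall q n (G : cgraph r C n), (q0 <= q <= n)%N ->
    2 / 3 <= sample_prob R m G P ->
    2 / 3 <= avg (fun S : redge q n =>
      (1 / 2 <= sample_prob R m (induced G (val S)) P)%R%:R) :> R.
Proof.
(* Chebyshev: dropping from 2/3 below 1/2 forces a deviation of at least 1/12, of probability at
   most [144 * 12 * x]; this is at most 1/3 since 5184 is three times 144 times 12. *)
exists (5184 * m ^ 2 + m + 1)%N => q n G /andP[q0q qn] GP.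
have q0 : (0 < q)%N by lia.
have mq : (m <= q)%N by lia.
have x_le : 5184%:R * (m%:R ^+ 2 / q%:R) <= 1 :> R by apply: ratio_le => //; lia.
have q_range : (1 <= q <= n)%N by rewrite q0.
pose b (w : {ffun 'I_m -> 'I_n}) : R := (edge_restr r (pull (tot c0 G) w) \in P m)%:R.
have b01 w : 0 <= b w <= 1 by rewrite /b; case: (_ \in _); rewrite /= ?ler01 ?lexx.
have := second_moment q_range b01; rewrite card_ord.
have V_le : `|avg b - avg_inj b| <= m%:R ^+ 2 / q%:R.
  apply: le_trans (avg_avg_inj _ b01) _; rewrite !card_ord ?(leq_trans q0)//.
  rewrite ler_wpM2l ?exprn_ge0 ?ler0n// lef_pV2 ?posrE ?ltr0n ?(leq_trans q0)//.
  by rewrite ler_nat.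
have S_le (S : redge q n) := avg_avg_inj_subsample S q0 b01.
rewrite (sample_prob_avg_inj _ _ (tot_val c0 _)) ?(leq_trans mq)// -/b in GP.
set x := m%:R ^+ 2 / q%:R in x_le V_le S_le *.
move=> sm; rewrite card_ord -/x in S_le.
have x0 : 0 <= x by rewrite divr_ge0 ?exprn_ge0.
suff : 1 - avg (fun S : redge q n => (1 / 2 <= sample_prob R m (induced G (val S)) P)%R%:R) <=
    144 * (12 * x) by lra.
have T0 : (0 < #|{: redge q n}|)%N by rewrite card_redge bin_gt0.
rewrite -{1}(@avg_cst R {: redge q n} 1)// -avgB.
apply: le_trans (ler_wpM2l _ sm); last by rewrite ler0n.
rewrite -avgZ; apply: ler_avg => S.
have -> : sample_prob R m (induced G (val S)) P = avg_inj (subsample b (S := val S)).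
  by rewrite (sample_prob_induced c0)// (eqP (valP S)).
have [_|] := lerP (1 / 2) (avg_inj (subsample b (S := val S))).
  by rewrite subrr mulr_ge0 ?sqr_ge0 ?ler0n.
move: (S_le S) V_le GP; rewrite !ler_norml.
move: (avg b) (avg_inj b) (avg (subsample b (S := _))) (avg_inj (subsample b (S := _))).
move=> a1 a2 a3 a4 /andP[s1 s2] /andP[v1 v2] GP a4_lt; rewrite subr0.
have d : 1 / 12 <= a1 - a3 by lra.
by nra.
Qed.

(** If the uncolored statistics of the sample are within [delta] of those of [G], an accepted
    coloring of the sample lifts to a coloring of [G] accepted with probability at least
    [1/2 - 1/24 - 3/25], which exceeds 1/3. Markov's inequality bounds the other samples. *)
Lemma sample_sound k (k0 : 'I_k) (Q : property r (bool * 'I_k)%type) :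
  exists q0 : nat, forall q n (G : Defs.rgraph r n), (q0 <= q <= n)%N ->
    (forall GG : cgraph r (bool * 'I_k)%type n, discolor GG = G ->
      sample_prob R m GG Q <= 1 / 3) ->
    avg (fun S : redge q n =>
      [exists FF : cgraph r (bool * 'I_k)%type #|val S|,
        (discolor FF == induced G (val S)) && (1 / 2 <= sample_prob R m FF Q)%R]%:R)
    <= 1 / 3 :> R.
Proof.
have e0 : 0 < 24%:R^-1 :> R by rewrite invr_gt0 ltr0n.
have [M [delta delta0 lift]] := lift_coloring k0 m e0.
pose D := #|{ffun {set 'I_M + 'I_m} -> bool}|.
have D0 : 0 < D%:R :> R.
  by rewrite ltr0n; apply/card_gt0P; exists [ffun => false].
(* A mean deviation of [theta] for each of the [D] patterns adds up to [delta / 3]. *)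
pose theta := delta / (3 * D%:R).
have theta0 : 0 < theta by rewrite divr_gt0// mulr_gt0// ltr0n.
pose N := (M + m)%N.
pose q1 := (Num.truncn (12 * N%:R ^+ 2 / theta ^+ 2)).+1.
exists (25 * m ^ 2 + m + q1)%N => q n G /andP[q0q qn] Gfar.
have q0 : (0 < q)%N by lia.
have mq : (m <= q)%N by lia.
have x_le : 25%:R * (m%:R ^+ 2 / q%:R) <= 1 :> R by apply: ratio_le => //; lia.
have q_range : (1 <= q <= n)%N by rewrite q0.
have T0 : (0 < #|{: redge q n}|)%N by rewrite card_redge bin_gt0.
pose b (gam : {ffun {set 'I_M + 'I_m} -> bool}) (w : {ffun 'I_M + 'I_m -> 'I_n}) : R :=
  (pull (tot false G) w == gam)%:R.
have b01 gam w : 0 <= b gam w <= 1 by rewrite /b; case: (_ == _); rewrite /= ?ler01 ?lexx.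
pose X (S : redge q n) := \sum_gam `|avg (subsample (b gam) (S := val S)) - avg (b gam)|.
have N_le : 12 * (N%:R ^+ 2 / q%:R) <= theta ^+ 2.
  rewrite mulrA ler_pdivrMr ?ltr0n// [theta ^+ 2 * _]mulrC -ler_pdivrMr ?exprn_gt0//.
  apply: (@le_trans _ _ q1%:R); first exact/ltW/truncnS_gt.
  by rewrite ler_nat; lia.
have X_le : avg X <= delta / 3.
  rewrite avg_sum (_ : delta / 3 = \sum_(gam : {ffun {set 'I_M + 'I_m} -> bool}) theta); last first.
    by rewrite sumr_const -/D -[_ *+ _]mulr_natr /theta; field; rewrite gt_eqF.
  apply: ler_sum => gam _; have := second_moment q_range (b01 gam).
  rewrite card_sum !card_ord -/N => sm.
  (* The mean absolute deviation is bounded through the mean square, by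
     [|d| <= d^2 / (2 theta) + theta / 2]. *)
  apply: (@le_trans _ _ (avg (fun S : redge q n => (2 * theta)^-1 *
     (avg (subsample (b gam) (S := val S)) - avg (b gam)) ^+ 2 + theta / 2))).
    apply: ler_avg => S; set d := _ - _.
    have : 0 <= (`|d| - theta) ^+ 2 * (2 * theta)^-1.
      by rewrite mulr_ge0 ?sqr_ge0// invr_ge0 mulr_ge0 ?ler0n ?(ltW theta0).
    rewrite sqrrB real_normK ?num_real// (_ : _ * (2 * theta)^-1 =
      (2 * theta)^-1 * d ^+ 2 + theta / 2 - `|d|); first by lra.
    by field; rewrite gt_eqF.
  rewrite avgD avg_cst// avgZ.
  have : (2 * theta)^-1 * avg (fun S : redge q n =>
      (avg (subsample (b gam) (S := val S)) - avg (b gam)) ^+ 2) <= (2 * theta)^-1 * theta ^+ 2.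
    apply: ler_wpM2l; first by rewrite invr_ge0 mulr_ge0 ?ler0n ?(ltW theta0).
    exact: le_trans sm N_le.
  rewrite (_ : (2 * theta)^-1 * theta ^+ 2 = theta / 2); first by lra.
  by field; rewrite gt_eqF.
(* Markov: it suffices that the indicator is at most [X S / delta]. *)
rewrite (_ : 1 / 3 = delta^-1 * (delta / 3)); last by field; rewrite gt_eqF.
apply: le_trans (ler_wpM2l _ X_le); last by rewrite invr_ge0 ltW.
rewrite -avgZ; apply: ler_avg => S.
have X0 : 0 <= X S by exact: sumr_ge0.
case: existsP => [[FF /andP[/eqP FFd FFacc]]|_] /=; last first.
  by rewrite mulr_ge0// invr_ge0 ltW.
rewrite mulrC ler_pdivlMr// mul1r leNgt; apply/negP => X_lt.
have Sq : #|val S| = q by exact/eqP/(valP S).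
have U0 : (0 < #|'I_#|val S| |)%N by rewrite card_ord Sq.
have V0 : (0 < #|'I_n|)%N by rewrite card_ord (leq_trans q0).
pose h (a : {ffun {set 'I_m} -> bool * 'I_k}) : R := (edge_restr r a \in Q m)%:R.
have h01 a : 0 <= h a <= 1 by rewrite /h; case: (_ \in _); rewrite /= ?ler01 ?lexx.
pose c f := (tot (false, k0) FF f).2.
have law : \sum_(gam : {ffun {set 'I_M + 'I_m} -> bool})
    `|avg (fun w : {ffun _ -> 'I_#|val S|} => (pull (tot false (induced G (val S))) w == gam)%:R) -
      avg (fun w : {ffun _ -> 'I_n} => (pull (tot false G) w == gam)%:R)| <= delta.
  apply: le_trans (ltW X_lt); rewrite le_eqVlt; apply/orP; left; apply/eqP.
  apply: eq_bigr => gam _; congr `| _ - _ |; apply: eq_avg => w.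
  by rewrite pull_induced.
have [c' cP] := lift _ _ _ c _ h h01 U0 V0 law.
pose GG : cgraph r (bool * 'I_k)%type n := [ffun e => (G e, c' (val e))].
have GGd : discolor GG = G by apply/ffunP => e; rewrite !ffunE.
have := Gfar _ GGd.
rewrite (sample_prob_avg_inj _ _ (H := fun f => (tot false G f, c' f))) ?(leq_trans mq)//;
  last by move=> e; rewrite tot_val ffunE.
rewrite (sample_prob_avg_inj _ _ (H := fun f => (tot false (induced G (val S)) f, c f))) in FFacc;
  first last.
- by rewrite Sq.
- move=> e; rewrite tot_val -FFd ffunE /c tot_val; by case: (FF e).
have cU : #|'I_#|val S| | = q by rewrite card_ord.
pose bU (w : {ffun 'I_m -> 'I_#|val S|}) :=
  h (pull (fun f => (tot false (induced G (val S)) f, c f)) w).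
pose bV (w : {ffun 'I_m -> 'I_n}) := h (pull (fun f => (tot false G f, c' f)) w).
rewrite -[avg_inj _]/(avg_inj bU) in FFacc; rewrite -[avg_inj _]/(avg_inj bV).
rewrite -[avg _]/(avg bU) -[X in _ <= X]/(avg bV) in cP.
have := avg_avg_inj (b := bU) U0 (fun w => h01 _).
have := avg_avg_inj (b := bV) V0 (fun w => h01 _).
rewrite cU !card_ord !ler_norml in cP *.
have n_le : m%:R ^+ 2 / n%:R <= m%:R ^+ 2 / q%:R :> R.
  rewrite ler_wpM2l ?exprn_ge0 ?ler0n// lef_pV2 ?posrE ?ltr0n ?(leq_trans q0)//.
  by rewrite ler_nat.
move: (avg bU) (avg_inj bU) (avg bV) (avg_inj bV) (m%:R ^+ 2 / n%:R)
  (m%:R ^+ 2 / q%:R) FFacc cP x_le n_le; clear.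
move=> a1 a2 a3 a4 y x acc lft xq yx /andP[v1 v2] /andP[u1 u2] rej.
by lra.
Qed.

End Transfer.

(** * The sample property *)

(** Discoloring maps [Q] into [P] and does not increase edit distance. *)
Lemma far_discolor (R : realType) r k n (eps : R) (Q : property r (bool * 'I_k)%type)
    (P : property r bool) (GG : cgraph r (bool * 'I_k)%type n) :
  (forall n, [set discolor G | G in Q n] = P n) -> far eps (discolor GG) P -> far eps GG Q.
Proof.
move=> QP Gfar H HQ; apply: le_trans (Gfar (discolor H) _) _.
  by rewrite -QP imset_f.
rewrite ler_nat subset_leq_card//; apply/subsetP => e; rewrite !inE !ffunE.
by apply: contraNneq => ->.
Qed.

Lemma discolor_relabel r k n (s : 'S_n) (G : cgraph r (bool * 'I_k)%type n) :
  discolor (relabel s G) = relabel s (discolor G).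
Proof. by apply/ffunP => e; rewrite !ffunE. Qed.

Lemma discolor_induced r k n (S : {set 'I_n}) (G : cgraph r (bool * 'I_k)%type n) :
  discolor (induced G S) = induced (discolor G) S.
Proof. by apply/ffunP => e; rewrite !ffunE. Qed.

Lemma relabelVK r (C : finType) n (s : 'S_n) (G : cgraph r C n) :
  relabel s^-1%g (relabel s G) = G.
Proof.
apply/ffunP => e; rewrite !ffunE; congr (G _); apply/eqP; rewrite -val_eqE /=; apply/eqP.
by rewrite -imset_comp -[RHS]imset_id; apply: eq_imset => i /=; rewrite permKV.
Qed.

Section SampleProperty.
Variables (R : realType) (r k : nat) (k0 : 'I_k) (Q : property r (bool * 'I_k)%type).
Variable scale : nat -> nat.
Hypothesis scale_le : forall q, (scale q <= q)%N.

(** Scale 0 means that the sample is too small for any test size; it is then accepted, for the sake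
    of completeness. *)
Definition colorable_pred n (F : cgraph r bool n) : bool :=
  (scale n == 0%N) || [exists FF : cgraph r (bool * 'I_k)%type n,
    (discolor FF == F) && (1 / 2 <= sample_prob R (scale n) FF Q)].

Lemma colorable_relabel_sub n (s : 'S_n) (F : cgraph r bool n) :
  colorable_pred F -> colorable_pred (relabel s F).
Proof.
case/orP => [s0|/existsP[FF /andP[/eqP <- acc]]]; apply/orP; [by left|right].
apply/existsP; exists (relabel s FF).
by rewrite discolor_relabel eqxx (sample_prob_relabel _ _ _ _ (false, k0)).
Qed.

Lemma colorable_relabel n (s : 'S_n) (F : cgraph r bool n) :
  (relabel s F \in [set F | colorable_pred F]) = (F \in [set F | colorable_pred F]).
Proof.
rewrite !inE; apply/idP/idP; last exact: colorable_relabel_sub.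
by move=> /(colorable_relabel_sub s^-1%g); rewrite relabelVK.
Qed.

Definition colorable : property r bool := Property colorable_relabel.

End SampleProperty.

Theorem theorem6p3 (R : realType) (r : nat) (hr : (1 <= r)%N)
    (P : property r bool) :
  nondet_testable R P -> testable R P.
Proof.
case=> k k1 [Q [Q' [Qcomp Qsound]] QP].
pose k0 : 'I_k := Ordinal k1.
pose good m q1 := forall q n, (q1 <= q <= n)%N ->
    (forall G : cgraph r (bool * 'I_k)%type n, 2 / 3 <= sample_prob R m G Q' ->
      2 / 3 <= avg (fun S : redge q n =>
        (1 / 2 <= sample_prob R m (induced G (val S)) Q')%R%:R) :> R) /\
    (forall G : Defs.rgraph r n,
      (forall GG : cgraph r (bool * 'I_k)%type n, discolor GG = G ->
        sample_prob R m GG Q' <= 1 / 3) ->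
      avg (fun S : redge q n =>
        [exists FF : cgraph r (bool * 'I_k)%type #|val S|,
          (discolor FF == induced G (val S)) && (1 / 2 <= sample_prob R m FF Q')%R]%:R)
      <= 1 / 3 :> R).
have [q0 q0P] : {q0 : nat -> nat & forall m, good m (q0 m)}.
  apply: boolp.choice => m.
  have [qc qcP] := sample_complete R m (false, k0) Q'.
  have [qs qsP] := sample_sound R m k0 Q'.
  exists (maxn qc qs) => q n; rewrite geq_max => /andP[/andP[cq sq] qn].
  by split=> G; [apply: qcP|apply: qsP]; rewrite ?cq ?sq.
(* The largest test size [m <= q] for which samples of size [q] are large enough, or 0 if there is
   none; it tends to infinity with [q]. *)
pose scale q := (\max_(m < q.+1 | q0 m <= q) m)%N.
have scale_le q : (scale q <= q)%N by apply/bigmax_leqP => m _; rewrite -ltnS.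
have scaleP q : scale q = 0%N \/ (q0 (scale q) <= q)%N.
  have [no|[m mq]] : (forall m : 'I_q.+1, ~~ (q0 m <= q)%N) \/ exists m : 'I_q.+1, (q0 m <= q)%N.
    have [/existsP|/existsPn] := boolP [exists m : 'I_q.+1, (q0 m <= q)%N]; by [right|left].
    by left; rewrite /scale big_pred0// => m; apply/negbTE.
  have [m' m'q ->] : {m' : 'I_q.+1 | (q0 m' <= q)%N & scale q = m'}.
    by apply: eq_bigmax_cond; apply/card_gt0P; exists m.
  by right.
have scale_ge m q : (m <= q)%N -> (q0 m <= q)%N -> (m <= scale q)%N.
  by move=> mq q0m; apply: (@leq_bigmax_cond _ _ _ (Ordinal (mq : m < q.+1)%N)).
have scaleS q n (S : redge q n) : scale #|val S| = scale q.
  by congr scale; exact/eqP/(valP S).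
have q0_scale q : (0 < scale q)%N -> (q0 (scale q) <= q)%N by case: (scaleP q) => // ->.
exists (colorable R k0 Q' scale_le); split.
  move=> n G q GP /andP[q1 qn]; have T0 : (0 < #|{: redge q n}|)%N by rewrite card_redge bin_gt0.
  rewrite sample_prob_avg; have [s0|s_gt0] := posnP (scale q).
    apply: (@le_trans _ _ (avg (fun _ : redge q n => 1))); first by rewrite avg_cst//; lra.
    by apply: ler_avg => S; rewrite inE /colorable_pred scaleS s0.
  move: GP; rewrite -QP => /imsetP[GG GGQ ->].
  have GGacc : 2 / 3 <= sample_prob R (scale q) GG Q'.
    by apply: Qcomp => //; rewrite s_gt0 (leq_trans (scale_le q)).
  have [|comp _] := q0P (scale q) q n; first by rewrite q0_scale.
  apply: le_trans (comp _ GGacc) _; apply: ler_avg => S; rewrite ler_nat.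
  have [acc|_ //] := lerP (1 / 2) (sample_prob R (scale q) (induced GG (val S)) Q').
  rewrite lt0b inE /colorable_pred scaleS; apply/orP; right.
  by apply/existsP; exists (induced GG (val S)); rewrite discolor_induced eqxx.
move=> eps eps0; have [m0 m0_gt0 m0P] := Qsound _ eps0.
(* From this size on the scale is at least [m0], so the witness test rejects every coloring of a far
   graph. *)
exists (maxn m0 (q0 m0)); first by rewrite leq_max m0_gt0.
move=> q n G; rewrite geq_max => /andP[m0q q0m0] qn Gfar.
have sge : (m0 <= scale q)%N by exact: scale_ge.
have s_gt0 : (0 < scale q)%N by exact: leq_trans m0_gt0 _.
have [|_ sound] := q0P (scale q) q n; first by rewrite q0_scale.
rewrite sample_prob_avg; apply: le_trans (sound G _); last first.
  move=> GG GGd; apply: m0P => //; first exact: leq_trans (scale_le q) qn.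
  by apply: far_discolor QP _; rewrite GGd.
apply: ler_avg => S; rewrite ler_nat inE /colorable_pred scaleS.
by rewrite (gtn_eqF s_gt0).
Qed.
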